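(* Let $Y$ be a random variable with stable law $\phi_{c,\alpha,\beta}$ (where $c>0$, $\alpha\in(0,2]$, $\beta\in[-1,1]$), and let $(U_t)_{t\ge0}$ be the corresponding Ornstein–Uhlenbeck process with starting point $x$ and speed $v$. Then $$d_{\mathrm{Kol}}(U_t,Y)=\begin{cases}O(e^{-vt})&\text{if }\alpha\in(1,2],\ x\ne0,\\ O(e^{-\alpha vt})&\text{if }\alpha\in(0,1),\text{ or }\alpha=1,\ \beta=0,\text{ or }\alpha\in(1,2],\ x=0,\\ O(vt\,e^{-vt})&\text{if }\alpha=1,\ \beta\neq0,\end{cases}$$ with constants in the $O(\cdot)$ depending only on $x$ and $\alpha$.
   Context: $d_{\mathrm{Kol}}(X,Y)=\sup_{a\in\mathbb R}|\mathbb P[X\le a]-\mathbb P[Y\le a]|$ is the Kolmogorov distance. The stable law $\phi_{c,\alpha,\beta}$ is the probability law on $\mathbb R$ with $\int e^{ix\xi}\phi_{c,\alpha,\beta}(dx)=e^{\eta_{c,\alpha,\beta}(i\xi)}$, where $\eta_{c,\alpha,\beta}(i\xi)=-|c\xi|^\alpha(1-i\beta\,h(\alpha,\xi)\,\mathrm{sgn}(\xi))$, $h(\alpha,\xi)=\tan(\frac{\pi\alpha}{2})$ if $\alpha\neq1$ and $h(1,\xi)=-\frac2\pi\log|\xi|$. Ornstein–Uhlenbeck processes: given a Lévy–Khintchine triplet $(l,\nu^2,\rho)$ ($l\in\mathbb R$, $\nu^2\ge0$, $\rho$ a Lévy measure on $\mathbb R\setminus\{0\}$, i.e. integrating $\min(1,|x|^2)$),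 let $(Z_t)_{t\ge0}$ be the Lévy process with $\mathbb E[e^{i\xi Z_t}]=\exp(t\psi(i\xi))$, $\psi(i\xi)=il\xi-\frac{\nu^2\xi^2}{2}+\int_{\mathbb R}(e^{i\xi x}-1-1_{|x|<1}i\xi x)\,\rho(dx)$. The Ornstein–Uhlenbeck process with this triplet, speed $v$ and starting point $x$ is the process $U_t=e^{-vt}x+\int_0^te^{-v(t-s)}\,dZ_s$; its marginals satisfy $\mathbb E[e^{i\xi U_t}]=\exp\left(i\xi e^{-vt}x+\int_0^t\psi(i\xi e^{-vs})\,ds\right)$. The law $\phi=\phi_{c,\alpha,\beta}$ is self-decomposable (it is infinitely divisible and for any $b\in(0,1)$ there is a probability measure $p_b$ with $\widehat\phi(\xi)=\widehat\phi(b\xi)\,\widehat p_b(\xi)$). By a theorem of Sato and Yamazato there is then, for each fixed speed $v$, a unique triplet with $\int_{|x|\ge1}\log|x|\,\rho(dx)<\infty$ for which $U_t$ converges in law to $\phi$ for every starting point, and $\widehat\phi(\xi)=\exp\left(\int_0^\infty\psi(i\xi e^{-vs})\,ds\right)$. The process associated with this triplet is the Ornstein–Uhlenbeck process corresponding to $\phi_{c,\alpha,\beta}$.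
   Formalization: For α∈(1,2], x≠0 and for α=1, β=0 the constant depends on x/c and α, since one independent of c is impossible (for α=2 the distance is ~|x|e^{-vt}/(2c√π)); v>0, and the bounds hold once vt exceeds a threshold that may depend on c, α, x. *)

(* Defs.v *)
(* Written in MathComp-Analysis, over an arbitrary [R : realType]; complex
   numbers are [R[i]] from mathcomp-real-closed. *)
From HB Require Import structures.
From mathcomp Require Export all_boot all_order all_algebra.
From mathcomp Require Export all_classical all_reals all_analysis.
From mathcomp Require Export complex.

Set Implicit Arguments.
Unset Strict Implicit.
Unset Printing Implicit Defensive.

Export Order.TTheory GRing.Theory Num.Theory.
Export numFieldNormedType.Exports.

#[export] Set Implicit Arguments.
#[export] Unset Strict Implicit.
#[export] Unset Printing Implicit Defensive.

#[global] Open Scope classical_set_scope.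
#[global] Open Scope ring_scope.
#[global] Open Scope complex_scope.

Definition cexp (R : realType) (z : R[i]) : R[i] :=
  expR (complex.Re z) * cos (complex.Im z) +i*
  (expR (complex.Re z) * sin (complex.Im z)).

Definition Cintegral (R : realType) (d : measure_display)
    (T : measurableType d) (mu : {measure set T -> \bar R})
    (f : T -> R[i]) : R[i] :=
  (\int[mu]_x complex.Re (f x)) +i* (\int[mu]_x complex.Im (f x)).

Definition charfun (R : realType) (mu : {measure set R -> \bar R})
    (xi : R) : R[i] :=
  Cintegral mu (fun x => cexp (0 +i* (x * xi))).

Definition Kolmogorov_dist (R : realType) (d d' : measure_display)
    (T : measurableType d) (T' : measurableType d')
    (P : probability T R) (Q : probability T' R)
    (X : {RV P >-> R}) (Y : {RV Q >-> R}) : R :=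
  sup (range (fun a : R =>
    `|fine (P [set w | X w <= a]) - fine (Q [set w | Y w <= a])|)).

Definition stable_h (R : realType) (alpha xi : R) : R :=
  if alpha == 1 then - (2 / pi) * ln `|xi| else tan (pi * alpha / 2).

(* [stable_exponent c alpha beta xi] is eta_{c,alpha,beta}(i xi); at
   [alpha = 1], [xi = 0] the junk value [ln 0 = 0] is multiplied by 0. *)
Definition stable_exponent (R : realType) (c alpha beta xi : R) : R[i] :=
  (- `|c * xi| `^ alpha)%:C *
  (1 -i* (beta * stable_h alpha xi * Num.sg xi)).

Definition stable_law (R : realType) (c alpha beta : R)
    (phi : {measure set R -> \bar R}) : Prop :=
  forall xi : R, charfun phi xi = cexp (stable_exponent c alpha beta xi).

Record triplet (R : realType) := Triplet {
  drift : R;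
  gauss_var : R;
  jumps : {measure set R -> \bar R}
}.

Definition Levy_Khintchine (R : realType) (tau : triplet R) : Prop :=
  [/\ 0 <= gauss_var tau,
      jumps tau [set 0] = 0%E &
      (\int[jumps tau]_x (Num.min 1 (`|x| ^+ 2))%:E < +oo)%E].

(* [Levy_exponent tau xi] is psi(i xi). *)
Definition Levy_exponent (R : realType) (tau : triplet R) (xi : R) : R[i] :=
  (- (gauss_var tau * xi ^+ 2 / 2)) +i* (drift tau * xi) +
  Cintegral (jumps tau) (fun x : R =>
    cexp (0 +i* (xi * x)) - 1 - (0 +i* (\1_[set y : R | `|y| < 1] x * (xi * x)))).

Definition cadlag (R : realType) (f : R -> R) : Prop :=
  (forall t : R, 0 <= t -> f s @[s --> t^'+] --> f t) /\
  (forall t : R, 0 < t -> cvg (f s @[s --> t^'-])).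

(* Processes are indexed by all of [R]; only times [t >= 0] are meaningful. *)
Definition past (R : realType) (d : measure_display) (T : measurableType d)
    (P : probability T R) (Z : R -> {RV P >-> R}) (s : R) : set (set T) :=
  <<s [set A | exists u : R, 0 <= u <= s /\
         exists2 B : set R, measurable B & A = Z u @^-1` B] >>.

Definition Levy_process (R : realType) (tau : triplet R)
    (d : measure_display) (T : measurableType d) (P : probability T R)
    (Z : R -> {RV P >-> R}) : Prop :=
  [/\ {ae P, forall w, Z 0 w = 0},
      (forall (s t : R) (A : set T) (B : set R), 0 <= s <= t ->
        past Z s A -> measurable B ->
        P (A `&` [set w | B (Z t w - Z s w)]) =
        (P A * P [set w | B (Z t w - Z s w)%R])%E),
      (forall (s t : R) (B : set R), 0 <= s <= t -> measurable B ->
        P [set w | B (Z t w - Z s w)] = P [set w | B (Z (t - s) w)]),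
      {ae P, forall w, cadlag (fun t => Z t w)} &
      forall t xi : R, 0 <= t ->
        charfun (distribution P (Z t)) xi =
        cexp (t%:C * Levy_exponent tau xi)].

Definition cvg_in_probability (R : realType) (d : measure_display)
    (T : measurableType d) (P : probability T R)
    (X : nat -> T -> R) (Y : T -> R) : Prop :=
  forall e : R, 0 < e ->
    P [set w | e <= `|X n w - Y w|] @[n --> \oo] --> 0%E.

(* [I] is the integral of [f] against [dZ] over [0, t]: the limit in
   probability of the Riemann sums over uniform partitions.  For continuous
   [f] and a Levy process [Z] the limit exists, is the same along any
   partitions with mesh tending to 0, and is unique up to a null set. *)
Definition is_stochastic_integral (R : realType) (d : measure_display)
    (T : measurableType d) (P : probability T R) (Z : R -> {RV P >-> R})
    (f : R -> R) (t : R) (I : T -> R) : Prop :=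
  cvg_in_probability P
    (fun n w => \sum_(k < n)
       f (t * k%:R / n%:R) *
       (Z (t * k.+1%:R / n%:R) w - Z (t * k%:R / n%:R) w)) I.

Definition Ornstein_Uhlenbeck (R : realType) (tau : triplet R) (v x : R)
    (d : measure_display) (T : measurableType d) (P : probability T R)
    (U : R -> {RV P >-> R}) : Prop :=
  exists2 Z : R -> {RV P >-> R}, Levy_process tau Z &
    forall t : R, 0 <= t ->
      is_stochastic_integral Z (fun s => expR (- (v * (t - s)))) t
        (fun w => U t w - expR (- (v * t)) * x).

Definition cvg_in_law (R : realType) (mu : R -> probability R R)
    (nu : probability R R) : Prop :=
  forall f : R -> R, continuous f -> (exists M : R, forall x, `|f x| <= M) ->
    \int[mu t]_x f x @[t --> +oo] --> \int[nu]_x f x.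

(* The triplet attached by the theorem of Sato and Yamazato to a
   self-decomposable law [phi] at speed [v]. *)
Definition corresponding_triplet (R : realType) (v : R)
    (phi : probability R R) (tau : triplet R) : Prop :=
  [/\ Levy_Khintchine tau,
      (\int[jumps tau]_(x in [set x : R | (1 <= `|x|)%R]) (ln `|x|)%:E < +oo)%E &
      forall (d : measure_display) (T : measurableType d)
             (P : probability T R) (y : R) (U : R -> {RV P >-> R}),
        Ornstein_Uhlenbeck tau v y U ->
        cvg_in_law (fun t => distribution P (U t)) phi].

(* Main.v *)
From HB Require Import structures.
Require Import Defs.
From mathcomp Require Import ring lra measurable_realfun.

(** Write [b = exp (- v t)], and let [phi] be the characteristic function of
    the stable law.  Since the increments of the driving Levy process are
    independent and stationary, a Riemann sum for the stochastic integral over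
    [[0, (m + 1) t]] is the sum of two independent terms: a Riemann sum over
    [[0, t]] and [b] times one over [[0, m t]].  In the limit
    [m -> oo] the characteristic function [g] of [U_t - b x] satisfies
    [phi xi = g xi * phi (b xi)], and the Levy exponent never has to be computed.

    With [phi] explicit, [U_t] and [Y] have characteristic functions that differ
    at [xi], up to a constant, by at most [exp (- |c xi|^alpha / 2)] times the sum
    of [b |x xi|] and the modulus of the stable exponent at [b xi].  Esseen's inequality, in the
    form where the integral of [|phi_U - phi_Y| / |xi|] over all frequencies
    bounds the Kolmogorov distance up to a constant, gives the rates.  It is
    proved by smoothing with a Cauchy law, whose distribution function is
    [1 / 2 + atan (x / sg) / pi] and whose characteristic function is
    [exp (- sg |xi|)]. *)

(** * Expectations and characteristic functions of random variables *)

Lemma bounded_integrable (R : realType) (d : measure_display)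
    (T : measurableType d) (mu : {measure set T -> \bar R}) (D : set T)
    (f : T -> R) (M : R) :
  measurable D -> (mu D < +oo)%E -> measurable_fun D f ->
  (forall x, D x -> `|f x| <= M) -> mu.-integrable D (EFin \o f).
Proof.
move=> mD muD mf fM; apply: measurable_bounded_integrable => //.
by exists M; split => [|N /ltW MN x Dx /=]; [exact: num_real|exact: le_trans (fM _ Dx) MN].
Qed.

Lemma bounded_RV_integrable (R : realType) (d : measure_display)
    (T : measurableType d) (P : probability T R) (f : T -> R) (M : R) :
  measurable_fun setT f -> (forall x, `|f x| <= M) ->
  P.-integrable setT (EFin \o f).
Proof.
move=> mf fM; apply: (@bounded_integrable _ _ _ P setT f M) => //.
by apply: (le_lt_trans (probability_le1 P _)); rewrite ?ltry.
Qed.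

Lemma Rintegral_cst_probability (R : realType) (d : measure_display)
    (T : measurableType d) (P : probability T R) (c : R) :
  \int[P]_w c = c.
Proof.
rewrite Rintegral_cst // -[RHS]mulr1; congr (_ * _).
exact: (congr1 fine (probability_setT P)).
Qed.

Lemma EFin_Rintegral_distribution (R : realType) (d : measure_display)
    (T : measurableType d) (P : probability T R) (X : {mfun T >-> R})
    (f : R -> R) (M : R) :
  measurable_fun setT f -> (forall x, `|f x| <= M) ->
  (\int[distribution P X]_x (f x)%:E = (\int[P]_w f (X w))%:E)%E.
Proof.
move=> mf fM.
have ifX : P.-integrable setT (EFin \o (f \o X)).
  apply: (@bounded_RV_integrable _ _ _ _ (f \o X) M) => [|w]; last exact: fM.
  exact: measurableT_comp.
rewrite /Rintegral fineK; last exact: integrable_fin_num.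
by rewrite integral_distribution //; exact/measurable_EFinP.
Qed.

(** Independence on rectangles makes the joint law the product of the two laws, by uniqueness of
    product measures; Fubini then factors the integral. *)
Lemma indep_expectation (R : realType) (d : measure_display)
    (T : measurableType d) (P : probability T R) (X W : {mfun T >-> R})
    (f g : R -> R) (M N : R) :
  (forall A B : set R, measurable A -> measurable B ->
     P (X @^-1` A `&` W @^-1` B) = (P (X @^-1` A) * P (W @^-1` B))%E) ->
  measurable_fun setT f -> measurable_fun setT g ->
  (forall x, `|f x| <= M) -> (forall x, `|g x| <= N) ->
  \int[P]_w (f (X w) * g (W w)) = (\int[P]_w f (X w)) * (\int[P]_w g (W w)).
Proof.
move=> indXW mf mg fM gN.
have mXW : measurable_fun setT (fun w => (X w, W w)).
  by apply/measurable_fun_pairP; split; exact: measurable_funPT.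
pose XW : {mfun T >-> (R * R)%type} :=
  HB.pack (fun w => (X w, W w)) (isMeasurableFun.Build _ _ _ _ _ mXW).
pose h (z : R * R) := f z.1 * g z.2.
have mh : measurable_fun setT h.
  by apply: measurable_funM; apply: measurableT_comp.
have hMN z : `|h z| <= M * N by rewrite normrM ler_pM.
pose p := (distribution P X \x distribution P W)%E.
have ih : p.-integrable setT (EFin \o h) by exact: bounded_RV_integrable hMN.
have -> : \int[P]_w (f (X w) * g (W w)) = fine (\int[distribution P XW]_z (h z)%:E).
  rewrite integral_distribution //; first exact/measurable_EFinP.
  apply: (@bounded_RV_integrable _ _ _ _ (h \o XW) (M * N)) => [|w].
    exact: measurableT_comp.
  exact: hMN.
rewrite -(@eq_measure_integral _ _ _ _ (distribution P XW) p); last first.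
  move=> A mA _; exact: product_measure_unique.
rewrite -(integral12_prod_meas1 ih) /fubini_F /=.
rewrite (eq_integral (fun x => (f x * \int[P]_w g (W w))%:E)); last first.
  move=> x _; rewrite EFinM -(EFin_Rintegral_distribution P W mg gN) //.
  rewrite -integralZl //.
  exact: (bounded_RV_integrable _ mg gN).
set c := \int[P]_w g (W w).
rewrite (EFin_Rintegral_distribution P X (f := fun x => f x * c) (M := M * `|c|)) /=.
- rewrite RintegralZr //; apply: (@bounded_RV_integrable _ _ _ _ (f \o X) M) => [|w].
    exact: measurableT_comp.
  exact: fM.
- exact: measurable_funM.
- by move=> x; rewrite normrM ler_wpM2r.
Qed.

Lemma measurable_cosM (R : realType) (xi : R) :
  measurable_fun setT (fun x : R => cos (xi * x)).
Proof.
apply: continuous_measurable_fun => x.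
by apply: continuous_comp; [exact: mulrl_continuous|exact: continuous_cos].
Qed.

Lemma measurable_sinM (R : realType) (xi : R) :
  measurable_fun setT (fun x : R => sin (xi * x)).
Proof.
apply: continuous_measurable_fun => x.
by apply: continuous_comp; [exact: mulrl_continuous|exact: continuous_sin].
Qed.

(** The characteristic function computed on the underlying space. It takes a plain function, so that
    sums, multiples and translates need no bundling; [charfun_distribution] links it to
    [charfun]. *)
Definition ecf (R : realType) (d : measure_display) (T : measurableType d)
    (P : probability T R) (X : T -> R) (xi : R) : R[i] :=
  (\int[P]_w cos (xi * X w)) +i* (\int[P]_w sin (xi * X w)).

Section ecf.
Context (R : realType) (d : measure_display) (T : measurableType d)
  (P : probability T R).
Implicit Types (X W : {mfun T >-> R}) (xi : R).

Lemma cosRV_integrable X xi :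
  P.-integrable setT (EFin \o (fun w => cos (xi * X w))).
Proof.
apply: (@bounded_RV_integrable _ _ _ _ _ 1) => [|w]; last exact: cos_max.
exact: (measurableT_comp (measurable_cosM xi) (measurable_funPT X)).
Qed.

Lemma sinRV_integrable X xi :
  P.-integrable setT (EFin \o (fun w => sin (xi * X w))).
Proof.
apply: (@bounded_RV_integrable _ _ _ _ _ 1) => [|w]; last exact: sin_max.
exact: (measurableT_comp (measurable_sinM xi) (measurable_funPT X)).
Qed.

Lemma charfun_distribution X xi : charfun (distribution P X) xi = ecf P X xi.
Proof.
rewrite /charfun /Cintegral /ecf /Rintegral /=; congr (_ +i* _); congr fine.
  under eq_integral do rewrite expR0 mul1r mulrC.
  rewrite (EFin_Rintegral_distribution P X (measurable_cosM xi) (M := 1)).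
    by rewrite /Rintegral fineK //; exact: integrable_fin_num (cosRV_integrable _ _).
  by move=> x; exact: cos_max.
under eq_integral do rewrite expR0 mul1r mulrC.
rewrite (EFin_Rintegral_distribution P X (measurable_sinM xi) (M := 1)).
  by rewrite /Rintegral fineK //; exact: integrable_fin_num (sinRV_integrable _ _).
by move=> x; exact: sin_max.
Qed.

Lemma eq_law_ecf X W xi :
  (forall B : set R, measurable B -> P (X @^-1` B) = P (W @^-1` B)) ->
  ecf P X xi = ecf P W xi.
Proof.
move=> XW; rewrite -!charfun_distribution /charfun /Cintegral /Rintegral.
by congr (fine _ +i* fine _); apply: eq_measure_integral => A mA _; exact: XW.
Qed.

Lemma ecf_scale (X : T -> R) (c xi : R) :
  ecf P (fun w => c * X w) xi = ecf P X (xi * c).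
Proof. by rewrite /ecf; congr (_ +i* _); apply: eq_Rintegral => w _; rewrite mulrA. Qed.

Lemma ecf_indepD X W xi :
  (forall A B : set R, measurable A -> measurable B ->
     P (X @^-1` A `&` W @^-1` B) = (P (X @^-1` A) * P (W @^-1` B))%E) ->
  ecf P (fun w => X w + W w) xi = ecf P X xi * ecf P W xi.
Proof.
move=> XW.
have mc := measurable_cosM xi; have ms := measurable_sinM xi.
have c1 (x : R) : `|cos (xi * x)| <= 1 := cos_max _.
have s1 (x : R) : `|sin (xi * x)| <= 1 := sin_max _.
have prodint (f g : R -> R) : measurable_fun setT f -> measurable_fun setT g ->
    (forall x, `|f x| <= 1) -> (forall x, `|g x| <= 1) ->
    P.-integrable setT (EFin \o (fun w => f (X w) * g (W w))).
  move=> mf mg f1 g1; apply: (@bounded_RV_integrable _ _ _ _ _ 1) => [|w].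
    by apply: measurable_funM; exact: measurableT_comp.
  by rewrite normrM -[leRHS]mulr1 ler_pM.
have -> : ecf P X xi * ecf P W xi =
    ((\int[P]_w cos (xi * X w)) * (\int[P]_w cos (xi * W w)) -
     (\int[P]_w sin (xi * X w)) * (\int[P]_w sin (xi * W w))) +i*
    ((\int[P]_w cos (xi * X w)) * (\int[P]_w sin (xi * W w)) +
     (\int[P]_w sin (xi * X w)) * (\int[P]_w cos (xi * W w))).
  by [].
rewrite -(indep_expectation XW mc mc c1 c1) -(indep_expectation XW ms ms s1 s1).
rewrite -(indep_expectation XW mc ms c1 s1) -(indep_expectation XW ms mc s1 c1).
rewrite -(RintegralB _ (prodint _ _ mc mc c1 c1) (prodint _ _ ms ms s1 s1)) //.
rewrite -(RintegralD _ (prodint _ _ mc ms c1 s1) (prodint _ _ ms mc s1 c1)) //.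
rewrite /ecf; congr (_ +i* _); apply: eq_Rintegral => w _.
  by rewrite mulrDr cosD.
by rewrite mulrDr sinD addrC.
Qed.

End ecf.

Lemma cos_lip (R : realType) (x y : R) : `|cos x - cos y| <= `|x - y|.
Proof.
wlog yx : x y / y <= x.
  move=> H; case: (leP y x) => [/H //|/ltW /H].
  by rewrite distrC [leRHS]distrC.
have [|c _ ->] := @MVT_segment R cos (fun z => - sin z) y x yx.
  by apply: continuous_subspaceT => z; exact: continuous_cos.
by rewrite normrM normrN ler_piMl // sin_max.
Qed.

Lemma sin_lip (R : realType) (x y : R) : `|sin x - sin y| <= `|x - y|.
Proof.
wlog yx : x y / y <= x.
  move=> H; case: (leP y x) => [/H //|/ltW /H].
  by rewrite distrC [leRHS]distrC.
have [|c _ ->] := @MVT_segment R sin cos y x yx.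
  by apply: continuous_subspaceT => z; exact: continuous_sin.
by rewrite normrM ler_piMl // cos_max.
Qed.

(** On the event [dl <= |X n - Y|], of small probability, the integrand moves by at most 2; off it
    the Lipschitz bound applies. *)
Lemma cvg_in_probability_expectation (R : realType) (d : measure_display)
    (T : measurableType d) (P : probability T R) (X : nat -> {mfun T >-> R})
    (Y : {mfun T >-> R}) (k : R -> R) (L : R) :
  measurable_fun setT k -> (forall x, `|k x| <= 1) ->
  (forall x y, `|k x - k y| <= L * `|x - y|) ->
  cvg_in_probability P (fun n => X n) Y ->
  \int[P]_w k (X n w) @[n --> \oo] --> \int[P]_w k (Y w).
Proof.
move=> mk k1 kL XY; apply/cvgrPdist_le => e e0.
have L0 : 0 <= L by have := kL 1 0; rewrite subr0 normr1 mulr1; exact: le_trans.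
(* The two parts contribute [L * dl <= e / 2] and [2 * (e / 4)]; [L + 1] keeps the denominator
   positive when [L = 0]. *)
pose dl := e / (2 * (L + 1)).
have dl0 : 0 < dl by rewrite divr_gt0 // mulr_gt0 // ltr_wpDl.
have Ldl : L * dl <= e / 2.
  by rewrite /dl mulrA ler_pdivrMr ?mulr_gt0 ?ltr_wpDl //; lra.
have kint (Z : {mfun T >-> R}) : P.-integrable setT (EFin \o (k \o Z)).
  apply: (@bounded_RV_integrable _ _ _ _ _ 1) => [|w]; last exact: k1.
  exact: measurableT_comp.
have /fine_cvg /= XYd := XY _ dl0.
have e40 : 0 < e / 4 by rewrite divr_gt0.
have /cvgrPdist_le /(_ _ e40) := XYd.
apply: filterS => n /=; rewrite sub0r normrN => Pn.
pose A := [set w | dl <= `|X n w - Y w|].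
have mA : measurable A.
  have mXY : measurable_fun setT (fun w => `|X n w - Y w|).
    by apply: measurableT_comp => //; exact: measurable_funB.
  by rewrite -[A]setTI; have := mXY measurableT _ (measurable_itv `[dl, +oo[);
    congr (measurable (_ `&` _)); apply/seteqP; split => w /=;
    rewrite in_itv /= andbT.
have mI : measurable_fun setT (\1_A : T -> R) by exact: measurable_indic.
have i1 (w : T) : 0 <= (\1_A w : R) <= 1.
  by rewrite indicE; case: (_ \in _); rewrite ?ler01 ?lexx.
have iA : P.-integrable setT (EFin \o (\1_A : T -> R)).
  apply: (@bounded_RV_integrable _ _ _ _ _ 1) => [//|w].
  by have /andP[? ?] := i1 w; rewrite ger0_norm.
rewrite -RintegralB //; try exact: kint.
have ibnd : P.-integrable setT (EFin \o (fun w => L * dl + 2 * \1_A w)).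
  apply: (@bounded_RV_integrable _ _ _ _ _ (L * dl + 2)) => [|w].
    by apply: measurable_funD => //; apply: measurable_funM => //; exact: mI.
  have /andP[? ?] := i1 w.
  have Ld : 0 <= L * dl by rewrite mulr_ge0 // ltW.
  by rewrite ger0_norm; lra.
apply: le_trans (le_normr_Rintegral _ _) _ => //.
  have := @integrableB _ _ _ P setT measurableT _ _ (kint Y) (kint (X n)).
  by apply.
apply: le_trans (_ : \int[P]_w (L * dl + 2 * \1_A w) <= _).
  apply: le_Rintegral => //.
    have := @integrableB _ _ _ P setT measurableT _ _ (kint Y) (kint (X n)).
    by move/integrable_norm.
  move=> w _; rewrite indicE; case: (boolP (w \in A)) => [_|].
    have := k1 (Y w); have := k1 (X n w); rewrite !ler_norml.
    have Ld : 0 <= L * dl by rewrite mulr_ge0 // ltW.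
    by move=> /= /andP[? ?] /andP[? ?]; rewrite mulr1; apply/andP; split; lra.
  rewrite mulr0 addr0 notin_setE /A /= => /negP; rewrite -ltNge => Xdl.
  by apply: le_trans (kL _ _) _; rewrite ler_wpM2l // distrC ltW.
have iA2 : P.-integrable setT (EFin \o (fun w => 2 * (\1_A w : R))).
  apply: (@bounded_RV_integrable _ _ _ _ _ 2) => [|w].
    by apply: measurable_funM => //; exact: mI.
  have /andP[? ?] := i1 w.
  by rewrite ger0_norm; lra.
rewrite RintegralD //; last first.
  by apply: (@bounded_RV_integrable _ _ _ _ _ (L * dl)) => // w;
    rewrite ger0_norm // mulr_ge0 // ltW.
rewrite (RintegralZl _ _ iA) // Rintegral_cst_probability.
have -> : \int[P]_w \1_A w = fine (P A).
  by rewrite /Rintegral integral_indic // setIT.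
by have := ler_norm (fine (P A)); rewrite -/A in Pn; lra.
Qed.

(** * Riemann sums against a Levy process *)

Section Levy_sums.
Context (R : realType) (d : measure_display) (T : measurableType d)
  (P : probability T R) (tau : triplet R) (Z : R -> {RV P >-> R}).
Hypothesis LZ : Levy_process tau Z.
Variables (s f : nat -> R).
Hypotheses (s0 : 0 <= s 0%N) (sS : forall k, s k <= s k.+1).

Let incr k w := Z (s k.+1) w - Z (s k) w.
Let wsum n w := \sum_(k < n) f k * incr k w.

Let s_ge0 k : 0 <= s k.
Proof. by elim: k => // k; move/le_trans; exact. Qed.

Let s_mono : {homo s : m n / (m <= n)%N >-> m <= n}.
Proof. by apply: homo_leq => // ? ? ?; exact: le_trans. Qed.

(** The sum involves [Z] only up to time [s n]. Measurability is obtained by giving [T] the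
    sigma-algebra generated by that past and checking each summand. *)
Let past_measurable_wsum n (B : set R) :
  measurable B -> past Z (s n) (wsum n @^-1` B).
Proof.
move=> mB; pose G := [set A | exists u : R, 0 <= u <= s n /\
         exists2 B : set R, measurable B & A = Z u @^-1` B].
have mZ k : (k <= n)%N ->
    measurable_fun setT (Z (s k) : g_sigma_algebraType G -> R).
  move=> kn _ C mC; rewrite setTI; apply: sub_gen_smallest.
  by exists (s k); split; [rewrite s_ge0 s_mono|exists C].
have mW : measurable_fun setT (wsum n : g_sigma_algebraType G -> R).
  apply: measurable_sum => k; apply: measurable_funM => //.
  by apply: measurable_funB; apply: mZ; rewrite // ltnW.
by have := mW measurableT B mB; rewrite setTI.
Qed.

(** By induction on [n]: the last increment is independent of the past, hence of the partial sum,
    and stationarity replaces it by [Z] at the step length. *)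
Lemma ecf_Levy_sum n xi :
  ecf P (fun w => \sum_(k < n) f k * (Z (s k.+1) w - Z (s k) w)) xi =
  \prod_(k < n) ecf P (Z (s k.+1 - s k)) (xi * f k).
Proof.
have [_ ind stat _ _] := LZ.
have mincr k : measurable_fun setT (incr k) by exact: measurable_funB.
have mwsum m : measurable_fun setT (wsum m).
  by apply: measurable_sum => k; exact: measurable_funM.
pose I k : {mfun T >-> R} := HB.pack (incr k) (isMeasurableFun.Build _ _ _ _ _ (mincr k)).
pose S m : {mfun T >-> R} := HB.pack (wsum m) (isMeasurableFun.Build _ _ _ _ _ (mwsum m)).
have mfincr k : measurable_fun setT (fun w => f k * incr k w) by exact: measurable_funM.
pose F k : {mfun T >-> R} := HB.pack (fun w => f k * incr k w)
  (isMeasurableFun.Build _ _ _ _ _ (mfincr k)).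
elim: n => [|n IH].
  rewrite big_ord0 /ecf.
  under eq_Rintegral do rewrite big_ord0 mulr0 cos0.
  under [X in _ +i* X]eq_Rintegral do rewrite big_ord0 mulr0 sin0.
  by rewrite !Rintegral_cst_probability.
rewrite big_ord_recr /= -IH.
have -> : (fun w => \sum_(k < n.+1) f k * (Z (s k.+1) w - Z (s k) w)) =
    (fun w => S n w + F n w) by apply/funext => w; rewrite big_ord_recr.
rewrite (@ecf_indepD _ _ _ P (S n) (F n)); last first.
  move=> A B mA mB.
  (* The weight [f n] is moved into the Borel set, since independence is assumed for the bare
     increments. *)
  have mB' : measurable ((fun x => f n * x) @^-1` B).
    by rewrite -[X in measurable X]setTI; exact: (mulrl_measurable _ measurableT).
  apply: (ind (s n) (s n.+1) _ ((fun x => f n * x) @^-1` B)) => //.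
    by rewrite s_ge0 sS.
  exact: past_measurable_wsum.
congr (_ * _); rewrite ecf_scale.
apply: (eq_law_ecf (X := I n)) => B mB.
by apply: stat; rewrite ?s_ge0 ?sS.
Qed.

End Levy_sums.

(** * The characteristic function of the Ornstein-Uhlenbeck process *)

(** Componentwise, so that every limit reduces to limits of real sequences. *)
Definition ccvg (R : realType) (u : nat -> R[i]) (l : R[i]) : Prop :=
  complex.Re (u n) @[n --> \oo] --> complex.Re l /\
  complex.Im (u n) @[n --> \oo] --> complex.Im l.

Lemma ccvgM (R : realType) (u w : nat -> R[i]) (l m : R[i]) :
  ccvg u l -> ccvg w m -> ccvg (fun n => u n * w n) (l * m).
Proof.
move=> [ur ui] [wr wi]; split.
  have -> : (fun n => complex.Re (u n * w n)) = (fun n =>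
    complex.Re (u n) * complex.Re (w n) - complex.Im (u n) * complex.Im (w n)).
    by apply/funext => n; case: (u n) (w n) => [? ?] [? ?].
  have -> : complex.Re (l * m) =
    complex.Re l * complex.Re m - complex.Im l * complex.Im m.
    by case: l m {ur ui wr wi} => [? ?] [? ?].
  by apply: cvgB; exact: cvgM.
have -> : (fun n => complex.Im (u n * w n)) = (fun n =>
  complex.Re (u n) * complex.Im (w n) + complex.Im (u n) * complex.Re (w n)).
  by apply/funext => n; case: (u n) (w n) => [? ?] [? ?].
have -> : complex.Im (l * m) =
  complex.Re l * complex.Im m + complex.Im l * complex.Re m.
  by case: l m {ur ui wr wi} => [? ?] [? ?].
by apply: cvgD; exact: cvgM.
Qed.

Lemma ccvg_cst (R : realType) (l : R[i]) : ccvg (fun=> l) l.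
Proof. by split; exact: cvg_cst. Qed.

Lemma ccvg_unique (R : realType) (u : nat -> R[i]) (l m : R[i]) :
  ccvg u l -> ccvg u m -> l = m.
Proof.
case: l m => [a b] [a' b'] [/= ua ub] [/= ua' ub'].
by congr (_ +i* _);
  [exact: (cvg_unique (@Rhausdorff R) ua ua')|exact: (cvg_unique (@Rhausdorff R) ub ub')].
Qed.

Lemma ccvg_comp (R : realType) (u : nat -> R[i]) (l : R[i]) (k : nat -> nat) :
  k n @[n --> \oo] --> \oo -> ccvg u l -> ccvg (u \o k) l.
Proof.
by move=> koo [ur ui]; split; [exact: (cvg_comp _ _ koo ur)|exact: (cvg_comp _ _ koo ui)].
Qed.

Lemma cvg_mulSn m : (m.+1 * n)%N @[n --> \oo] --> \oo.
Proof.
by apply/cvgnyPge => A; exists A => // n /= An; rewrite (leq_trans An) ?leq_pmull.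
Qed.

Definition cis (R : realType) (y : R) : R[i] := cos y +i* sin y.

Lemma ecf_addc (R : realType) (d : measure_display) (T : measurableType d)
    (P : probability T R) (X : {mfun T >-> R}) (c xi : R) :
  ecf P (fun w => X w + c) xi = ecf P X xi * cis (xi * c).
Proof.
have ic := cosRV_integrable P X xi; have isn := sinRV_integrable P X xi.
have icZ (k : R) : P.-integrable setT (EFin \o (fun w => cos (xi * X w) * k)).
  by have := integrableZr measurableT k ic.
have isZ (k : R) : P.-integrable setT (EFin \o (fun w => sin (xi * X w) * k)).
  by have := integrableZr measurableT k isn.
transitivity
    (((\int[P]_w cos (xi * X w)) * cos (xi * c) -
      (\int[P]_w sin (xi * X w)) * sin (xi * c)) +i*
     ((\int[P]_w cos (xi * X w)) * sin (xi * c) +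
      (\int[P]_w sin (xi * X w)) * cos (xi * c))); last by [].
rewrite -!RintegralZr // -RintegralB // -RintegralD //.
rewrite /ecf; congr (_ +i* _); apply: eq_Rintegral => w _.
  by rewrite mulrDr cosD.
by rewrite mulrDr sinD addrC.
Qed.

Lemma cvg_in_probability_ecf (R : realType) (d : measure_display)
    (T : measurableType d) (P : probability T R) (X : nat -> {mfun T >-> R})
    (Y : {mfun T >-> R}) (xi : R) :
  cvg_in_probability P (fun n => X n) Y ->
  ccvg (fun n => ecf P (X n) xi) (ecf P Y xi).
Proof.
move=> XY; split => /=.
  apply: (cvg_in_probability_expectation (k := fun x => cos (xi * x)) (L := `|xi|)) => //.
  - exact: measurable_cosM.
  - by move=> x; exact: cos_max.
  - by move=> x y; apply: le_trans (cos_lip _ _) _; rewrite -mulrBr normrM.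
apply: (cvg_in_probability_expectation (k := fun x => sin (xi * x)) (L := `|xi|)) => //.
- exact: measurable_sinM.
- by move=> x; exact: sin_max.
- by move=> x y; apply: le_trans (sin_lip _ _) _; rewrite -mulrBr normrM.
Qed.

Section OU_flow.
Context (R : realType) (d : measure_display) (T : measurableType d)
  (P : probability T R) (tau : triplet R) (Z : R -> {RV P >-> R}).
Hypothesis LZ : Levy_process tau Z.
Variables (v x t : R) (U : R -> {RV P >-> R}).
Hypothesis UZ : forall r : R, 0 <= r ->
  is_stochastic_integral Z (fun s => expR (- (v * (r - s)))) r
    (fun w => U r w - expR (- (v * r)) * x).
Hypothesis t0 : 0 < t.

Let S r n w := \sum_(k < n) expR (- (v * (r - r * k%:R / n%:R))) *
  (Z (r * k.+1%:R / n%:R) w - Z (r * k%:R / n%:R) w).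
Let g r xi := ecf P (fun w => U r w - expR (- (v * r)) * x) xi.
(* The characteristic function of [S (m t) (m n)], in reverse order of time. *)
Let E m n xi := \prod_(j < m * n)
  ecf P (Z (t / n%:R)) (xi * expR (- (v * (t * j.+1%:R / n%:R)))).

Let g_cvg r xi : 0 <= r -> ccvg (fun n => ecf P (S r n) xi) (g r xi).
Proof.
move=> r0.
have mS n : measurable_fun setT (S r n).
  apply: measurable_sum => k; apply: measurable_funM => //.
  exact: measurable_funB.
have mg : measurable_fun setT (fun w => U r w - expR (- (v * r)) * x).
  exact: measurable_funB.
pose SS n : {mfun T >-> R} := HB.pack (S r n) (isMeasurableFun.Build _ _ _ _ _ (mS n)).
pose G : {mfun T >-> R} := HB.pack (fun w => U r w - expR (- (v * r)) * x)
  (isMeasurableFun.Build _ _ _ _ _ mg).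
exact: (@cvg_in_probability_ecf _ _ _ P SS G xi (UZ r0)).
Qed.

(** A partition of [[0, (m + 1) t]] into [(m + 1) (n + 1)] steps has mesh [t / (n + 1)] whatever [m]
    is. Reversing the index turns the weight into a function of the time left before the horizon. *)
Let ecf_S m n xi : ecf P (S (m.+1%:R * t) (m.+1 * n.+1)) xi = E m.+1 n.+1 xi.
Proof.
have m0 : m.+1%:R != 0 :> R by rewrite pnatr_eq0.
have n0 : n.+1%:R != 0 :> R by rewrite pnatr_eq0.
have := ecf_Levy_sum LZ
  (s := fun k => m.+1%:R * t * k%:R / (m.+1 * n.+1)%:R)
  (fun k => expR (- (v * (m.+1%:R * t - m.+1%:R * t * k%:R / (m.+1 * n.+1)%:R)))).
move=> -> //.
- rewrite /E (reindex_inj rev_ord_inj) /=; apply: eq_bigr => k _.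
  rewrite -mulrBl -mulrBr -natrB ?subSnn; last by [].
  rewrite [(m.+1 * n.+1)%:R]natrM; congr (ecf P (Z _) (_ * expR (- (v * _)))).
    by move: m0 n0; move: (m.+1%:R) (n.+1%:R) => M N M0 N0; field; rewrite M0 N0.
  rewrite natrB ?ltn_ord // natrM.
  by move: m0 n0; move: (m.+1%:R) (n.+1%:R) => M N M0 N0; field; rewrite M0 N0.
- by rewrite mulr0 mul0r.
- by move=> k; rewrite ler_pM2r ?invr_gt0 ?ltr0n // ler_pM2l ?mulr_gt0 // ler_nat.
Qed.

(** The first [n] factors, those of the last stretch of length [t], form [E 1 n]; in each later
    factor the extra time [t] to the horizon scales the frequency by [exp (- v t)]. *)
Let E_S m n xi : E m.+1 n xi = E 1 n xi * E m n (xi * expR (- (v * t))).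
Proof.
rewrite /E mulSn mul1n big_split_ord /=; congr (_ * _).
apply: eq_bigr => j _; congr (ecf P _ _).
(* If [n] were 0 there would be no index [j] below [m * n]. *)
have n0 : n%:R != 0 :> R.
  by rewrite pnatr_eq0; case: n j => [[j /=]|//]; rewrite muln0.
rewrite -[RHS]mulrA -expRD -addnS natrD; congr (_ * expR _).
by move: n0; move: (n%:R) (j.+1%:R) => N J N0; field.
Qed.

(** The product identity [E_S] survives the limit [n -> oo]: the partitions into [(k + 1) (n + 1)]
    steps form a subsequence of the uniform ones, along which the Riemann sums converge. *)
Let g_flow m xi : g (m.+2%:R * t) xi = g t xi * g (m.+1%:R * t) (xi * expR (- (v * t))).
Proof.
have key k y : ccvg (fun n => E k.+1 n.+1 y) (g (k.+1%:R * t) y).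
  have kt0 : 0 <= k.+1%:R * t by rewrite mulr_ge0 // ltW.
  have -> : (fun n => E k.+1 n.+1 y) =
      ((fun n => ecf P (S (k.+1%:R * t) n) y) \o muln k.+1) \o addn^~ 1%N.
    by apply/funext => n; rewrite /comp addn1 ecf_S.
  exact: ccvg_comp (cvg_addnr 1) (ccvg_comp (cvg_mulSn k) (g_cvg y kt0)).
have := key 0%N xi; rewrite mul1r => /ccvgM /(_ (key m (xi * expR (- (v * t))))).
apply: ccvg_unique.
have -> : (fun n => E 1 n.+1 xi * E m.+1 n.+1 (xi * expR (- (v * t)))) =
    (fun n => E m.+2 n.+1 xi) by apply/funext => n; rewrite -E_S.
exact: key.
Qed.

Hypothesis v0 : 0 < v.

(** This is [g_flow] as [m -> oo]: since [v > 0] the starting point is forgotten, so [g] at the two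
    growing horizons tends to the characteristic function of [Y]. The factor [cis] restores the
    shift by [exp (- v t) x] in [U t]. *)
Lemma OU_flow (dY : measure_display) (TY : measurableType dY)
    (Q : probability TY R) (Y : {RV Q >-> R}) xi :
  cvg_in_law (fun r => distribution P (U r)) (distribution Q Y) ->
  charfun (distribution P (U t)) xi *
    charfun (distribution Q Y) (xi * expR (- (v * t))) =
  cis (xi * (expR (- (v * t)) * x)) * charfun (distribution Q Y) xi.
Proof.
move=> UY; set b := expR (- (v * t)).
have mty : m.+1%:R * t @[m --> \oo] --> +oo.
  apply/cvgryPge => A; near=> m; rewrite -ler_pdivrMr //.
  near: m; exists (Num.truncn `|A / t|).+1 => // m /= Am.
  apply: le_trans (ler_norm _) _; apply: ltW.
  apply: lt_le_trans (truncnS_gt _) _.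
  by rewrite ler_nat ltnW.
have gE r y : g r y = charfun (distribution P (U r)) y *
    cis (y * (- (expR (- (v * r)) * x))).
  by rewrite charfun_distribution -ecf_addc.
have gY y : ccvg (fun m => g (m.+1%:R * t) y) (charfun (distribution Q Y) y).
  have -> : (fun m => g (m.+1%:R * t) y) = (fun m =>
      charfun (distribution P (U (m.+1%:R * t))) y *
      cis (y * (- (expR (- (v * (m.+1%:R * t))) * x)))).
    by apply/funext => m; rewrite gE.
  rewrite -[X in ccvg _ X]mulr1; apply: ccvgM.
    have cB (f : R -> R) : continuous f -> (forall z, `|f z| <= 1) ->
        \int[distribution P (U (m.+1%:R * t))]_z f z @[m --> \oo] -->
        \int[distribution Q Y]_z f z.
      move=> cf f1; apply: (cvg_comp _ _ mty (UY f cf _)).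
      by exists 1.
    split => /=.
      under [X in X n @[n --> _]]eq_fun do
        under eq_Rintegral do rewrite expR0 mul1r mulrC.
      under eq_Rintegral do rewrite expR0 mul1r mulrC.
      apply: cB => [z|z]; last exact: cos_max.
      by apply: continuous_comp; [exact: mulrl_continuous|exact: continuous_cos].
    under [X in X n @[n --> _]]eq_fun do
      under eq_Rintegral do rewrite expR0 mul1r mulrC.
    under eq_Rintegral do rewrite expR0 mul1r mulrC.
    apply: cB => [z|z]; last exact: sin_max.
    by apply: continuous_comp; [exact: mulrl_continuous|exact: continuous_sin].
  have c0 : y * (- (expR (- (v * (m.+1%:R * t))) * x)) @[m --> \oo] --> (0 : R).
    have -> : (0 : R) = y * (- (0 * x)) by rewrite mul0r oppr0 mulr0.
    apply: cvgMl_tmp; apply: cvgN; apply: cvgMr_tmp.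
    have e0 : expR (- z) @[z --> +oo] --> (0 : R) by exact: cvgr_expR.
    have vm : v * z @[z --> +oo] --> +oo by exact: (gt0_cvgMry v0 cvg_id).
    have := cvg_comp _ (fun z => expR (- z)) (cvg_comp _ ( *%R v) mty vm) e0.
    exact.
  split => /=.
    by have := cvg_comp _ (@cos R) c0 (@continuous_cos R 0); rewrite cos0.
  by have := cvg_comp _ (@sin R) c0 (@continuous_sin R 0); rewrite sin0.
(* The sequence [g (m.+2%:R * t) xi] has two limits: the one of a shifted sequence and the one given
   by [g_flow]. *)
have E1 : charfun (distribution Q Y) xi =
    g t xi * charfun (distribution Q Y) (xi * b).
  apply: ccvg_unique (_ : ccvg (fun m => g (m.+2%:R * t) xi) _) _.
    have -> : (fun m => g (m.+2%:R * t) xi) =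
        (fun m => g (m.+1%:R * t) xi) \o addn^~ 1%N.
      by apply/funext => m; rewrite /comp addn1.
    exact: ccvg_comp (cvg_addnr 1) (gY xi).
  have -> : (fun m => g (m.+2%:R * t) xi) =
      (fun m => g t xi * g (m.+1%:R * t) (xi * b)).
    by apply/funext => m; rewrite g_flow.
  by apply: ccvgM => //; exact: ccvg_cst.
rewrite E1 gE -/b.
have cis1 : cis (xi * (b * x)) * cis (xi * - (b * x)) = 1.
  rewrite /cis mulrN cosN sinN; set c := cos _; set s := sin _.
  have <- : (c ^+ 2 + s ^+ 2) +i* 0 = 1 :> R[i] by rewrite cos2Dsin2.
  by apply/eqP; rewrite eq_complex /=; apply/andP; split; apply/eqP; ring.
by rewrite -[LHS]mul1r -cis1; ring.
Unshelve. all: by end_near. Qed.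

End OU_flow.

(** * Integrals over segments and bounded convergence *)

Lemma Rintegral_FTC (R : realType) (f F : R -> R) (a b : R) :
  a < b -> (forall z, a <= z <= b -> {for z, continuous f}) ->
  (forall z, a <= z <= b -> is_derive z 1 F (f z)) ->
  \int[lebesgue_measure]_(z in `[a, b]) f z = F b - F a.
Proof.
move=> ab cf dF; rewrite /Rintegral (@continuous_FTC2 _ f F) //.
- apply: continuous_in_subspaceT => z; rewrite inE /= in_itv /=; exact: cf.
- have cF z : a <= z <= b -> {for z, continuous F}.
    by move=> /dF [dz _]; apply: differentiable_continuous; exact/derivable1_diffP.
  split.
  + move=> z; rewrite in_itv /= => /andP[/ltW az /ltW zb].
    by have [] := dF z _; rewrite ?az.
  + by apply: cvg_at_right_filter; apply: cF; rewrite lexx ltW.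
  + by apply: cvg_at_left_filter; apply: cF; rewrite lexx ltW.
- move=> z; rewrite in_itv /= => /andP[/ltW az /ltW zb].
  by rewrite derive1E; have [] := dF z _; rewrite ?az.
Qed.

Lemma itv_bounded_integrable (R : realType) (f : R -> R) (a b M : R) :
  measurable_fun `[a, b] f -> (forall z, a <= z <= b -> `|f z| <= M) ->
  (@lebesgue_measure R).-integrable `[a, b] (EFin \o f).
Proof.
move=> mf fM; apply: (@bounded_integrable _ _ _ _ _ _ M) => //.
by rewrite /= lebesgue_measure_itv /=; case: ifP; rewrite ?ltry // -EFinD ltry.
Qed.

Lemma bounded_cvg_expectation (R : realType) (d : measure_display)
    (T : measurableType d) (P : probability T R) (f_ : nat -> T -> R)
    (f : T -> R) (M : R) :
  (forall n, measurable_fun setT (f_ n)) -> measurable_fun setT f ->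
  (forall n w, `|f_ n w| <= M) -> (forall w, f_ n w @[n --> \oo] --> f w) ->
  \int[P]_w f_ n w @[n --> \oo] --> \int[P]_w f w.
Proof.
move=> mf_ mf fM f_f.
have fM' w : `|f w| <= M.
  by apply: cvgr_to_le (cvg_norm (f_f w)) _; exact: nearW.
have M_int : P.-integrable setT (EFin \o (fun=> M : R)).
  apply: (@bounded_RV_integrable _ _ _ _ _ `|M|) => //.
have f_int : P.-integrable setT (EFin \o f) by exact: bounded_RV_integrable fM'.
have [|||||_ _] := @dominated_convergence _ _ _ P setT measurableT
  (fun n => EFin \o f_ n) (EFin \o f) (EFin \o (fun=> M)).
- by move=> n; exact/measurable_EFinP.
- exact/measurable_EFinP.
- by apply: aeW => w _; apply: cvg_EFin; [exact: nearW|exact: f_f].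
- exact: M_int.
- by apply: aeW => w n _; rewrite lee_fin fM.
move=> cvgI; apply: fine_cvg.
rewrite [X in _ --> X](_ : _ = (\int[P]_w (f w)%:E)%E) //.
by rewrite fineK //; exact: integrable_fin_num.
Unshelve. all: by end_near. Qed.

(** * Smoothing by Cauchy laws *)

Section Poisson_kernel.
Context (R : realType) (sg dl N : R).
Hypotheses (sg0 : 0 < sg) (dl0 : 0 < dl) (dlN : dl < N).

(** The primitive in [xi] of [cos (xi z) exp (- sg xi)] that vanishes at infinity; its value at 0 is
    minus the Poisson kernel [sg / (sg ^+ 2 + z ^+ 2)]. *)
Let Pk z xi := (expR (- (sg * xi)) * (z * sin (xi * z) - sg * cos (xi * z))) /
  (sg ^+ 2 + z ^+ 2).

Let den z : sg ^+ 2 + z ^+ 2 != 0.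
Proof. by rewrite gt_eqF // ltr_wpDr ?sqr_ge0 // exprn_gt0. Qed.

Let Pk_derive z (xi : R) : is_derive xi 1 (Pk z) (cos (xi * z) * expR (- (sg * xi))).
Proof.
rewrite /Pk.
apply: is_derive_eq.
have := den z; rewrite /GRing.scale /= => D.
by field.
Qed.

Let Pk_int z : \int[lebesgue_measure]_(xi in `[dl, N])
  (cos (xi * z) * expR (- (sg * xi))) = Pk z N - Pk z dl.
Proof.
apply: Rintegral_FTC => // xi _.
apply: cvgM; last first.
  apply: continuous_comp; last exact: continuous_expR.
  by apply: cvgN; exact: mulrl_continuous.
by apply: continuous_comp; [exact: mulrr_continuous|exact: continuous_cos].
Qed.

(** Over all positive frequencies the integral is exactly the Poisson kernel. The piece below [dl]
    costs at most [dl], the integrand being bounded by 1, and the piece above [N] equals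
    [- Pk z N]. *)
Lemma Poisson_kernel_error z :
  `|\int[lebesgue_measure]_(xi in `[dl, N]) (cos (xi * z) * expR (- (sg * xi)))
    - sg / (sg ^+ 2 + z ^+ 2)| <= dl + 2 * expR (- (sg * N)) / sg.
Proof.
have P0 : Pk z 0 = - (sg / (sg ^+ 2 + z ^+ 2)).
  by rewrite /Pk mulr0 oppr0 expR0 mul0r sin0 cos0; field; exact: den.
rewrite Pk_int (_ : _ - _ - _ = Pk z N - (Pk z dl - Pk z 0)); last by rewrite P0; ring.
apply: le_trans (ler_normB _ _) _; rewrite addrC lerD //.
  have [xi /[!in_itv] /= /andP[xi0 _] ->] := @MVT_segment R (Pk z) _ 0 dl (ltW dl0)
    (fun y _ => Pk_derive z y) (continuous_subspaceT (fun y =>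
      differentiable_continuous (proj1 (derivable1_diffP _ _)
        (@ex_derive _ _ _ _ _ _ _ (Pk_derive z y))))).
  rewrite subr0 normrM (gtr0_norm dl0) ler_piMl ?(ltW dl0) // normrM.
  rewrite -[leRHS]mulr1; apply: ler_pM => //; first exact: cos_max.
  rewrite ger0_norm ?expR_ge0 // -expR0 ler_expR.
  by rewrite oppr_le0 mulr_ge0 // ltW.
rewrite /Pk normrM normfV (gtr0_norm (_ : 0 < sg ^+ 2 + z ^+ 2)); last first.
  by rewrite ltr_wpDr ?sqr_ge0 // exprn_gt0.
rewrite normrM ger0_norm ?expR_ge0 // [2 * _]mulrC -!mulrA ler_wpM2l ?expR_ge0 //.
rewrite ler_pdivrMr ?ltr_wpDr ?sqr_ge0 ?exprn_gt0 // mulrAC ler_pdivlMr //.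
apply: (@le_trans _ _ ((`|z| + sg) * sg)).
  rewrite ler_wpM2r ?(ltW sg0) //; apply: le_trans (ler_normB _ _) _.
  rewrite !normrM (gtr0_norm sg0) lerD //.
    by rewrite ler_piMr // sin_max.
  by rewrite ler_piMr ?(ltW sg0) // cos_max.
rewrite -[z ^+ 2]real_normK ?num_real //.
have := sqr_ge0 (`|z| - sg); rewrite sqrrB !expr2; nra.
Qed.

End Poisson_kernel.

(** The factor [1 / xi] is written as a real power, whose measurability is at hand; the two agree at
    the positive [xi] over which it is integrated. *)
Definition Poisson_integrand (R : realType) (sg z xi : R) : R :=
  sin (xi * z) * xi `^ (-1) * expR (- (sg * xi)).

(** Truncation to [[dl, N]] of the integral over all positive frequencies, whose value is
    [atan (z / sg)]. *)
Definition Poisson_primitive (R : realType) (sg dl N z : R) : R :=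
  \int[lebesgue_measure]_(xi in `[dl, N]) Poisson_integrand sg z xi.

Section Poisson_primitive.
Context (R : realType) (sg dl N : R).
Hypotheses (sg0 : 0 < sg) (dl0 : 0 < dl) (dlN : dl < N).

Let f := Poisson_integrand sg.
Let df z xi := cos (xi * z) * expR (- (sg * xi)).
Let g := Poisson_primitive sg dl N.

Let pos xi : dl <= xi <= N -> 0 < xi.
Proof. by move=> /andP[/(lt_le_trans dl0)]. Qed.

Let cont_exp : continuous (fun xi : R => expR (- (sg * xi))).
Proof.
move=> xi; apply: continuous_comp; last exact: continuous_expR.
by apply: cvgN; exact: mulrl_continuous.
Qed.

Let mf z : measurable_fun `[dl, N] (f z).
Proof.
apply: measurable_funTS; apply: measurable_funM; last exact: continuous_measurable_fun.
apply: measurable_funM; last exact: measurable_powR.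
apply: continuous_measurable_fun => xi.
by apply: continuous_comp; [exact: mulrr_continuous|exact: continuous_sin].
Qed.

Let expR_sg_le1 xi : dl <= xi <= N -> expR (- (sg * xi)) <= 1.
Proof. by move=> /pos xi0; rewrite expR_le1 oppr_le0 mulr_ge0 ?(ltW sg0) // ltW. Qed.

Lemma Poisson_integrand_bound z xi :
  dl <= xi <= N -> `|Poisson_integrand sg z xi| <= dl^-1.
Proof.
move=> xiI; have xi0 := pos xiI; rewrite /f /Poisson_integrand !normrM powR_inv1 ?(ltW xi0) //.
rewrite normfV (gtr0_norm xi0) (ger0_norm (expR_ge0 _)).
rewrite -[leRHS]mulr1 ler_pM ?mulr_ge0 ?invr_ge0 ?(ltW xi0) ?expR_ge0 ?expR_sg_le1 //.
rewrite -[leRHS]mul1r ler_pM ?invr_ge0 ?(ltW xi0) ?sin_max // lef_pV2 ?posrE //.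
by case/andP: xiI.
Qed.

Lemma Poisson_integrand_integrable z :
  (@lebesgue_measure R).-integrable `[dl, N] (EFin \o Poisson_integrand sg z).
Proof. exact: itv_bounded_integrable (mf z) (Poisson_integrand_bound z). Qed.

Let f_derive (z xi : R) : dl <= xi <= N -> is_derive z 1 (f^~ xi) (df z xi).
Proof.
move=> xiI; have xi0 := pos xiI; rewrite /f /Poisson_integrand powR_inv1 ?(ltW xi0) //.
apply: is_derive_eq; rewrite /GRing.scale /= /df; field.
by rewrite gt_eqF.
Qed.

(** Differentiating in [z] cancels the factor [1 / xi] and leaves a derivative bounded by 1; this
    constant is the dominating function. *)
Lemma Poisson_primitive_derive (z : R) :
  is_derive z 1 (Poisson_primitive sg dl N) (\int[lebesgue_measure]_(xi in `[dl, N]) df z xi).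
Proof.
have zI : `](z - 1), (z + 1)[%classic z.
  by rewrite /= in_itv /=; apply/andP; split; lra.
have p1E u xi : dl <= xi <= N -> partial1of2 f u xi = df u xi.
  by move=> xiI; rewrite partial1of2E; have [_] := f_derive u xiI.
have iG : (@lebesgue_measure R).-integrable `[dl, N] (EFin \o (fun=> 1 : R)).
  by apply: (@itv_bounded_integrable _ _ _ _ 1) => // ? _; rewrite normr1.
have dfu (u xi : R) : `](z - 1), (z + 1)[%classic u -> `[dl, N]%classic xi ->
    derivable (f^~ xi) u 1.
  by move=> _; rewrite /= in_itv /= => xiI; have [] := f_derive u xiI.
have Gub (u xi : R) : `](z - 1), (z + 1)[%classic u -> `[dl, N]%classic xi ->
    `|partial1of2 f u xi| <= 1.
  move=> _; rewrite /= in_itv /= => xiI; rewrite p1E // /df normrM.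
  rewrite -[leRHS]mulr1 ler_pM ?cos_max // ger0_norm ?expR_ge0 //.
  exact: expR_sg_le1.
have fi (u : R) : `](z - 1), (z + 1)[%classic u ->
    (@lebesgue_measure R).-integrable `[dl, N] (EFin \o f u)
    by move=> _; exact: Poisson_integrand_integrable.
apply: DeriveDef.
  exact: (@derivable_under_integral R _ _ (@lebesgue_measure R) f _ (measurable_itv _) z _ _
    zI fi dfu (fun=> 1) (fun=> ler01) iG Gub).
rewrite -derive1E (@differentiation_under_integral R _ _ (@lebesgue_measure R) f _ (measurable_itv _) z _ _
    zI fi dfu (fun=> 1) (fun=> ler01) iG Gub) //.
by apply: eq_Rintegral => xi; rewrite inE /= in_itv /= => xiI; rewrite p1E.
Qed.

(** Mean value theorem for the primitive minus [atan (z / sg)]: the derivative of this difference is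
    the error in [Poisson_kernel_error]. *)
Lemma Poisson_primitive_atan p q : q <= p ->
  `|Poisson_primitive sg dl N p - Poisson_primitive sg dl N q - (atan (p / sg) - atan (q / sg))| <=
  (p - q) * (dl + 2 * expR (- (sg * N)) / sg).
Proof.
move=> qp.
pose h z := g z - atan (z / sg).
pose dh z := \int[lebesgue_measure]_(xi in `[dl, N]) df z xi - sg / (sg ^+ 2 + z ^+ 2).
have den (z : R) : sg ^+ 2 + z ^+ 2 != 0.
  by rewrite gt_eqF // ltr_wpDr ?sqr_ge0 // exprn_gt0.
have dhz (z : R) : is_derive z 1 h (dh z).
  have gz := Poisson_primitive_derive z.
  have H2 : is_derive z 1 ( *%R^~ sg^-1) sg^-1.
    by apply: is_derive_eq; rewrite /GRing.scale /=; ring.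
  have az := @is_derive1_comp _ atan ( *%R^~ sg^-1) z _ _ (is_derive1_atan _) H2.
  rewrite /h; apply: is_derive_eq; rewrite /dh; congr (_ - _).
  rewrite /GRing.scale /=; field.
  by rewrite den gt_eqF.
have [|c _] := @MVT_segment R h dh q p qp (fun z _ => dhz z).
  apply: continuous_subspaceT => z; apply: differentiable_continuous.
  by apply/derivable1_diffP; have [] := dhz z.
rewrite /h /g => E.
rewrite (_ : _ - _ - _ = dh c * (p - q)); last by rewrite -E; ring.
rewrite normrM mulrC (ger0_norm (_ : 0 <= p - q)) ?subr_ge0 // ler_wpM2l ?subr_ge0 //.
exact: Poisson_kernel_error.
Qed.

End Poisson_primitive.

(** [F] is bounded over [[a, b]] only, so it is extended by 0 outside the strip; the strip has
    finite product measure, which gives integrability. *)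
Lemma Fubini_itv (R : realType) (d : measure_display) (T : measurableType d)
    (P : probability T R) (F : T -> R -> R) (a b M : R) :
  measurable_fun setT (fun z : R * T => F z.2 z.1) ->
  (forall w xi, a <= xi <= b -> `|F w xi| <= M) ->
  (@lebesgue_measure R).-integrable `[a, b]
    (EFin \o (fun xi => \int[P]_w F w xi)) /\
  \int[P]_w \int[lebesgue_measure]_(xi in `[a, b]) F w xi =
  \int[lebesgue_measure]_(xi in `[a, b]) \int[P]_w F w xi.
Proof.
move=> mF FM.
pose leb := @lebesgue_measure R.
pose D : set (measurableTypeR R) := `[a, b]%classic.
have mD : measurable D by exact: measurable_itv.
have lebD : (leb D < +oo)%E.
  by rewrite /leb /D lebesgue_measure_itv /=; case: ifP; rewrite ?ltry // -EFinD ltry.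
pose DT : set (measurableTypeR R * T) := D `*` setT.
have mDT : measurable DT := measurableX mD measurableT.
pose f := (fun z : measurableTypeR R * T => (F z.2 z.1)%:E) \_ DT.
have fE w xi : f (xi, w) = ((fun y => (F w y)%:E) \_ D) xi.
  by rewrite /f /patch; congr (if _ then _ else _); apply/idP/idP;
    rewrite !inE => // -[].
have mFw w : measurable_fun setT (F w) by exact: (measurable_fun_pair1 w mF).
have mFxi xi : measurable_fun setT (F^~ xi) by exact: (measurable_fun_pair2 xi mF).
have intf : (leb \x P)%E.-integrable setT f.
  apply/(integrable_mkcond _ mDT).
  apply: (@bounded_integrable _ _ _ (leb \x P)%E DT (fun z => F z.2 z.1) M) => //.
  - rewrite [X in (X < _)%E](_ : _ = (leb D * P setT)%E); last exact: product_measure1E.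
    by rewrite muleC lte_mul_pinfty // fin_num_measure.
  - exact: measurable_funTS.
  - by move=> [xi w] [+ _]; rewrite /D /= in_itv /=; exact: FM.
have F1 w : (\int[leb]_xi f (xi, w) = (\int[leb]_(xi in D) F w xi)%:E)%E.
  under eq_integral do rewrite fE.
  rewrite -integral_mkcond /Rintegral fineK //.
  apply: integrable_fin_num => //.
  apply: (@itv_bounded_integrable _ _ _ _ M); last exact: FM.
  exact: measurable_funTS.
have F2 : fubini_F P f = (EFin \o (fun xi => \int[P]_w F w xi)) \_ D.
  apply/funext => xi; rewrite /fubini_F /=.
  under eq_integral do rewrite fE.
  rewrite /patch; case: ifPn => [|_]; last by rewrite integral0.
  rewrite inE /D /= in_itv /= => xiI.
  rewrite /Rintegral fineK //; apply: integrable_fin_num => //.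
  by apply: (@bounded_RV_integrable _ _ _ _ (F^~ xi) M) => // w; exact: FM.
split.
  by apply/(integrable_mkcond _ mD); rewrite -F2; exact: integrable_fubini_F.
rewrite /Rintegral; congr fine.
under eq_integral do rewrite -F1.
rewrite [LHS](integral21_prod_meas1 intf) -(integral12_prod_meas1 intf) F2.
by rewrite -integral_mkcond.
Qed.

Lemma atan_bounds (R : realType) (x : R) : `|atan x| <= pi / 2.
Proof.
by rewrite ler_norml; have := atan_gtNpi2 x; have := atan_ltpi2 x; move=> /ltW -> /ltW ->.
Qed.

Lemma measurable_atan (R : realType) : measurable_fun setT (@atan R).
Proof. by apply: continuous_measurable_fun => x; exact: continuous_atan. Qed.

Lemma ecf_sin_expectation (R : realType) (d : measure_display)
    (T : measurableType d) (P : probability T R) (X : {mfun T >-> R}) (p xi : R) :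
  \int[P]_w sin (xi * (p - X w)) =
  sin (xi * p) * complex.Re (ecf P X xi) - cos (xi * p) * complex.Im (ecf P X xi).
Proof.
have ic := cosRV_integrable P X xi; have isn := sinRV_integrable P X xi.
have icZ (k : R) : P.-integrable setT (EFin \o (fun w => k * cos (xi * X w))).
  by have := integrableZl measurableT k ic.
have isZ (k : R) : P.-integrable setT (EFin \o (fun w => k * sin (xi * X w))).
  by have := integrableZl measurableT k isn.
rewrite /ecf /= -!RintegralZl // -RintegralB //.
by apply: eq_Rintegral => w _; rewrite mulrBr sinB.
Qed.

(** For [phi = ecf P X], the expectation of the difference of the Poisson integrands at [p - X] and
    [q - X]. For [q <= p], its integral over positive frequencies is [pi] times the probability that
    [X] plus an independent Cauchy variable of scale [sg] lies between [q] and [p]. *)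
Definition atan_Fourier (R : realType) (sg p q : R) (phi : R -> R[i]) (xi : R) : R :=
  ((sin (xi * p) - sin (xi * q)) * complex.Re (phi xi) -
   (cos (xi * p) - cos (xi * q)) * complex.Im (phi xi)) *
  (xi `^ (-1) * expR (- (sg * xi))).

Section atan_differences.
Context (R : realType) (d : measure_display) (T : measurableType d)
  (P : probability T R) (X : {mfun T >-> R}).
Variables (sg dl N p q : R).
Hypotheses (sg0 : 0 < sg) (dl0 : 0 < dl) (dlN : dl < N) (qp : q <= p).

Let L := (p - q) * (dl + 2 * expR (- (sg * N)) / sg).
Let dG w := Poisson_primitive sg dl N (p - X w) - Poisson_primitive sg dl N (q - X w).
Let dA w := atan ((p - X w) / sg) - atan ((q - X w) / sg).

Let mX (c : R) : measurable_fun setT (fun w => c - X w).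
Proof. exact: measurable_funB. Qed.

Lemma atan_diff_integrable : P.-integrable setT (EFin \o dA).
Proof.
apply: (@bounded_RV_integrable _ _ _ _ _ pi) => [|w].
  have mc c : measurable_fun setT (fun w => atan ((c - X w) / sg)).
    apply: (measurableT_comp (@measurable_atan R)).
    by apply: measurable_funM => //; exact: mX.
  by apply: measurable_funB; exact: mc.
apply: le_trans (ler_normB _ _) _; rewrite [leRHS]splitr.
by rewrite lerD // atan_bounds.
Qed.

Let dG_dA w : `|dG w - dA w| <= L.
Proof.
have := @Poisson_primitive_atan R sg dl N sg0 dl0 dlN (p - X w) (q - X w).
by rewrite lerD2r => /(_ qp); rewrite (_ : p - X w - (q - X w) = p - q) //; ring.
Qed.

Let dG_integrable : P.-integrable setT (EFin \o dG).
Proof.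
apply: (@bounded_RV_integrable _ _ _ _ _ (L + pi)) => [|w].
  have mG : measurable_fun setT (Poisson_primitive sg dl N).
    apply: continuous_measurable_fun => z; apply: differentiable_continuous.
    by apply/derivable1_diffP; have [] := @Poisson_primitive_derive R sg dl N sg0 dl0 z.
  by apply: measurable_funB; apply: (measurableT_comp mG); exact: mX.
rewrite -(subrK (dA w) (dG w)); apply: le_trans (ler_normD _ _) _.
rewrite lerD // /dA; apply: le_trans (ler_normB _ _) _; rewrite [leRHS]splitr.
by rewrite lerD // atan_bounds.
Qed.

Let H := atan_Fourier sg p q (ecf P X).

(** The arctangents are replaced by Poisson primitives, with an error uniform in [w]; Fubini then
    exchanges expectation and frequency integral. *)
Lemma atan_diff_Fourier :
  (@lebesgue_measure R).-integrable `[dl, N] (EFin \o atan_Fourier sg p q (ecf P X)) /\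
  `|\int[P]_w (atan ((p - X w) / sg) - atan ((q - X w) / sg)) -
    \int[lebesgue_measure]_(xi in `[dl, N]) atan_Fourier sg p q (ecf P X) xi| <=
  (p - q) * (dl + 2 * expR (- (sg * N)) / sg).
Proof.
pose F w xi := Poisson_integrand sg (p - X w) xi - Poisson_integrand sg (q - X w) xi.
have mF : measurable_fun setT (fun z : R * T => F z.2 z.1).
  have mc (c : R) : measurable_fun setT
      (fun z : R * T => Poisson_integrand sg (c - X z.2) z.1).
    have mexp : measurable_fun setT (fun xi : R => xi `^ (-1) * expR (- (sg * xi))).
      apply: measurable_funM; first exact: measurable_powR.
      apply: continuous_measurable_fun => xi.
      by apply: continuous_comp; [apply: cvgN; exact: mulrl_continuous|exact: continuous_expR].
    rewrite /Poisson_integrand; under eq_fun do rewrite -mulrA.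
    apply: measurable_funM; last exact: (measurableT_comp mexp measurable_fst).
    apply: measurableT_comp; first exact: (continuous_measurable_fun (@continuous_sin R)).
    apply: measurable_funM; first exact: measurable_fst.
    exact: (measurableT_comp (mX c) measurable_snd).
  by apply: measurable_funB; exact: mc.
have FM w xi : dl <= xi <= N -> `|F w xi| <= dl^-1 + dl^-1.
  move=> xiI; apply: le_trans (ler_normB _ _) _.
  by rewrite lerD // (@Poisson_integrand_bound R sg dl N).
have [iF EF] := Fubini_itv P mF FM.
have FH xi : \int[P]_w F w xi = H xi.
  pose k := xi `^ (-1) * expR (- (sg * xi)).
  have ik (c : R) : P.-integrable setT (EFin \o (fun w => sin (xi * (c - X w)))).
    apply: (@bounded_RV_integrable _ _ _ _ _ 1) => [|w]; last exact: sin_max.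
    exact: (measurableT_comp (measurable_sinM xi) (mX c)).
  have ikZ (c : R) : P.-integrable setT (EFin \o (fun w => sin (xi * (c - X w)) * k)).
    by have := integrableZr measurableT k (ik c).
  rewrite /F /Poisson_integrand.
  under eq_Rintegral do rewrite -!mulrA -/k.
  rewrite RintegralB // !RintegralZr // !ecf_sin_expectation /H /atan_Fourier -/k.
  by ring.
have EH : \int[P]_w dG w = \int[lebesgue_measure]_(xi in `[dl, N]) H xi.
  transitivity (\int[lebesgue_measure]_(xi in `[dl, N]) \int[P]_w F w xi); last first.
    by apply: eq_Rintegral => xi _; exact: FH.
  rewrite -EF.
  apply: eq_Rintegral => w _; rewrite /dG /Poisson_primitive /F.
  by rewrite RintegralB //; exact: (@Poisson_integrand_integrable R sg dl N).
split.
  rewrite -/H.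
  have -> : H = (fun xi => \int[P]_w F w xi) by apply/funext => xi; rewrite FH.
  exact: iF.
rewrite -/H -/L -EH distrC -RintegralB //; last exact: atan_diff_integrable.
apply: le_trans (le_normr_Rintegral _ _) _ => //.
  by have := integrableB measurableT dG_integrable atan_diff_integrable.
rewrite -[leRHS](@Rintegral_cst_probability _ _ _ P).
apply: le_Rintegral => //.
- have := integrableB measurableT dG_integrable atan_diff_integrable.
  exact: integrable_norm.
- by apply: (@bounded_RV_integrable _ _ _ _ _ `|L|).
Qed.

End atan_differences.

(** * Esseen's inequality for the Kolmogorov distance *)

Section smoothing.
Context (R : realType) (d d' : measure_display) (T : measurableType d)
  (T' : measurableType d') (P : probability T R) (Q : probability T' R)
  (X : {mfun T >-> R}) (Y : {mfun T' >-> R}) (h : R -> R) (D : R).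
Hypothesis h_int : forall a b, 0 < a -> a < b ->
  (@lebesgue_measure R).-integrable `[a, b] (EFin \o h).
Hypothesis h_le : forall a b, 0 < a -> a < b ->
  \int[lebesgue_measure]_(xi in `[a, b]) h xi <= D.
Hypothesis ecf_diff : forall xi, 0 < xi ->
  `|complex.Re (ecf P X xi) - complex.Re (ecf Q Y xi)| +
  `|complex.Im (ecf P X xi) - complex.Im (ecf Q Y xi)| <= xi * h xi.

Let dA sg p q x : R := atan ((p - x) / sg) - atan ((q - x) / sg).

(** The bound is free of [sg], [p] and [q]: the truncation errors are made at most [e], and the
    factor 2 bounds the differences of two sines or two cosines. *)
Let atan_diff_le sg p q : 0 < sg -> q <= p ->
  `|\int[P]_w dA sg p q (X w) - \int[Q]_w dA sg p q (Y w)| <= 2 * D.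
Proof.
move=> sg0 qp; apply/ler_addgt0Pr => e e0.
pose L := p - q; have L0 : 0 <= L by rewrite subr_ge0.
(* Each of the two laws incurs a truncation error of at most [2 L dl]; the total [4 L dl] is
   [e L / (L + 1)], at most [e]. *)
pose dl := e / (4 * (L + 1)).
have dl0 : 0 < dl by rewrite divr_gt0 // mulr_gt0 // ltr_wpDl.
have Ldl : L * (dl + dl) + L * (dl + dl) <= e.
  have -> : L * (dl + dl) + L * (dl + dl) = e * (L / (L + 1)).
    by rewrite /dl; field; rewrite gt_eqF // ltr_wpDl.
  by rewrite ler_piMr ?(ltW e0) // ler_pdivrMr ?mul1r ?lerDl // ltr_wpDl.
(* From [exp y >= y], the tail [2 exp (- sg N) / sg] is at most [2 / (sg ^+ 2 * N)], which this [N]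
   brings below [dl]. *)
pose N := dl + 2 / (sg ^+ 2 * dl).
have M0 : 0 < 2 / (sg ^+ 2 * dl) by rewrite divr_gt0 // mulr_gt0 // exprn_gt0.
have dlN : dl < N by rewrite ltrDl.
have N0 : 0 < N by exact: lt_trans dlN.
have tail : 2 * expR (- (sg * N)) / sg <= dl.
  have sN0 : 0 < sg * N by rewrite mulr_gt0.
  apply: (@le_trans _ _ (2 / (sg * N) / sg)).
    rewrite ler_wpM2r ?invr_ge0 ?(ltW sg0) // ler_wpM2l // expRN.
    rewrite lef_pV2 ?posrE ?expR_gt0 //.
    by apply: le_trans (expR_ge1Dx _); rewrite lerDr.
  rewrite (_ : 2 / (sg * N) / sg = 2 / (sg ^+ 2 * N)); last first.
    by field; rewrite !gt_eqF.
  rewrite ler_pdivrMr ?mulr_gt0 ?exprn_gt0 //.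
  have -> : dl * (sg ^+ 2 * N) = dl * (sg ^+ 2 * dl) + 2.
    by rewrite /N; field; rewrite !gt_eqF.
  have d1 := ltW dl0; have s1 := sqr_ge0 sg.
  by rewrite lerDr mulr_ge0 // mulr_ge0.
have err : (p - q) * (dl + 2 * expR (- (sg * N)) / sg) <= L * (dl + dl).
  by rewrite ler_wpM2l // lerD2l.
have [iX EX] := @atan_diff_Fourier _ _ _ P X sg dl N p q sg0 dl0 dlN qp.
have [iY EY] := @atan_diff_Fourier _ _ _ Q Y sg dl N p q sg0 dl0 dlN qp.
set IX := \int[P]_w _; set IY := \int[Q]_w _.
set HX := atan_Fourier _ _ _ _ in iX EX; set HY := atan_Fourier _ _ _ _ in iY EY.
set JX := \int[lebesgue_measure]_(_ in _) _ in EX.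
set JY := \int[lebesgue_measure]_(_ in _) _ in EY.
have iXY : (@lebesgue_measure R).-integrable `[dl, N] (EFin \o (fun xi => HX xi - HY xi)).
  by have := @integrableB _ _ _ (@lebesgue_measure R) _ (measurable_itv _) _ _ iX iY.
have JXY : `|JX - JY| <= 2 * D.
  rewrite -RintegralB //.
  apply: le_trans (le_normr_Rintegral _ iXY) _ => //.
  apply: (@le_trans _ _ (\int[lebesgue_measure]_(xi in `[dl, N]) (2 * h xi))); last first.
    by rewrite RintegralZl ?ler_wpM2l ?h_le //; exact: h_int.
  apply: le_Rintegral => //.
  - exact: integrable_norm iXY.
  - by have := @integrableZl _ _ _ (@lebesgue_measure R) _ (measurable_itv _) 2 _ (h_int dl0 dlN).
  move=> xi; rewrite /= in_itv /= => /andP[dlxi _].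
  have xi0 : 0 < xi by exact: lt_le_trans dlxi.
  have xih := ecf_diff xi0.
  have h0 : 0 <= h xi.
    by rewrite -(pmulr_rge0 _ xi0); apply: le_trans xih; rewrite addr_ge0.
  pose s := sin (xi * p) - sin (xi * q); pose c := cos (xi * p) - cos (xi * q).
  have s2 : `|s| <= 2.
    by apply: le_trans (ler_normB _ _) _; rewrite (_ : 2 = 1 + 1) ?lerD ?sin_max.
  have c2 : `|c| <= 2.
    by apply: le_trans (ler_normB _ _) _; rewrite (_ : 2 = 1 + 1) ?lerD ?cos_max.
  rewrite /HX /HY /atan_Fourier -/s -/c.
  set a := complex.Re _ in xih *; set b := complex.Im _ in xih *.
  set a' := complex.Re _ in xih *; set b' := complex.Im _ in xih *.
  rewrite powR_inv1 ?(ltW xi0) //; set E := expR _.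
  have E1 : 0 <= E <= 1.
    by rewrite expR_ge0 expR_le1 oppr_le0 mulr_ge0 ?(ltW sg0) ?(ltW xi0).
  rewrite (_ : _ - _ = (s * (a - a') - c * (b - b')) * (xi^-1 * E)); last by ring.
  have [E0 E1'] := andP E1.
  rewrite normrM (ger0_norm (_ : 0 <= xi^-1 * E)) ?mulr_ge0 ?invr_ge0 ?(ltW xi0) //.
  apply: (@le_trans _ _ ((2 * (xi * h xi)) * (xi^-1 * 1))); last first.
    by rewrite mulr1 (_ : _ * _ / _ = 2 * h xi) //; field; rewrite gt_eqF.
  apply: ler_pM => //; rewrite ?mulr_ge0 ?invr_ge0 ?(ltW xi0) //.
    apply: le_trans (ler_normB _ _) _; rewrite !normrM.
    apply: (@le_trans _ _ (2 * `|a - a'| + 2 * `|b - b'|)).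
      by rewrite lerD // ler_wpM2r.
    by rewrite -mulrDr ler_wpM2l.
  by rewrite ler_wpM2l ?invr_ge0 ?(ltW xi0).
rewrite (_ : IX - IY = (IX - JX) - (IY - JY) + (JX - JY)); last by ring.
apply: le_trans (ler_normD _ _) _; rewrite addrC; apply: lerD => //.
apply: le_trans (ler_normB _ _) _; apply: le_trans Ldl.
by rewrite lerD //; [exact: le_trans EX err|exact: le_trans EY err].
Qed.

Let atan_cvg (u : nat -> R) : (\forall n \near \oo, n.+1%:R <= u n) ->
  atan (u n) @[n --> \oo] --> pi / 2.
Proof.
move=> un; have uy : u n @[n --> \oo] --> +oo.
  apply/cvgryPge => A; near=> n.
  apply: (@le_trans _ _ n.+1%:R); last by near: n.
  apply: le_trans (ler_norm _) _; apply/ltW; apply: lt_le_trans (truncnS_gt _) _.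
  by rewrite ler_nat; near: n; exact: nbhs_infty_ge.
by have := cvg_comp _ (@atan R) uy (@cvgy_atan R).
Unshelve. all: by end_near. Qed.

Let atanN_cvg (u : nat -> R) : (\forall n \near \oo, n.+1%:R <= - u n) ->
  atan (u n) @[n --> \oo] --> - (pi / 2).
Proof.
move=> /atan_cvg un; have -> : (fun n => atan (u n)) = (fun n => - atan (- u n)).
  by apply/funext => n; rewrite atanN opprK.
exact: cvgN.
Qed.

Let sgn (n : nat) : R := (n.+1%:R ^+ 2)^-1.

Let near_nat (A : R) : \forall n \near \oo, A <= n.+1%:R.
Proof.
near=> n; apply: le_trans (ler_norm _) _; apply/ltW.
apply: lt_le_trans (truncnS_gt _) _.
by rewrite ler_nat; near: n; exact: nbhs_infty_ge.
Unshelve. all: by end_near. Qed.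

(** The scale [sgn n] is the square of the shift [1 / (n + 1)]. At [x = a] the first arctangent
    therefore has argument [n + 1] and tends to [pi / 2], so that an atom at [a] is counted, as the
    non-strict inequality demands. *)
Let dA_cvg (a x : R) :
  dA (sgn n) (a + n.+1%:R^-1) (- n.+1%:R) x @[n --> \oo] --> pi * (x <= a)%R%:R.
Proof.
have pE n : (a + n.+1%:R^-1 - x) / sgn n = n.+1%:R * ((a - x) * n.+1%:R + 1).
  have n0 : n.+1%:R != 0 :> R by rewrite pnatr_eq0.
  by rewrite /sgn invrK; move: n0; move: (n.+1%:R) => k k0; field.
have q_cvg : atan ((- n.+1%:R - x) / sgn n) @[n --> \oo] --> - (pi / 2).
  apply: atanN_cvg; have := near_nat (1 - x); apply: filterS => n nx.
  rewrite /sgn invrK.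
  rewrite (_ : - _ = n.+1%:R * (n.+1%:R * (n.+1%:R + x))); last by ring.
  have n1 : 1 <= n.+1%:R :> R by rewrite ler1n.
  rewrite ler_peMr // -[leLHS]mulr1 ler_pM //; lra.
case: (leP x a) => xa.
  rewrite mulr1 [pi in X in _ --> X]splitr -[X in _ + X]opprK.
  apply: cvgB q_cvg; apply: atan_cvg; apply: nearW => n; rewrite pE.
  by rewrite ler_peMr // lerDr mulr_ge0 // subr_ge0.
rewrite mulr0 -(subrr (- (pi / 2))).
apply: cvgB q_cvg; apply: atanN_cvg.
have := near_nat (2 / (x - a)); apply: filterS => n nx.
rewrite pE -mulrN ler_peMr //.
move: nx; rewrite ler_pdivrMr ?subr_gt0 //; lra.
Qed.

Let cdf_cvg (d0 : measure_display) (T0 : measurableType d0) (P0 : probability T0 R)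
    (X0 : {mfun T0 >-> R}) (a : R) :
  \int[P0]_w dA (sgn n) (a + n.+1%:R^-1) (- n.+1%:R) (X0 w) @[n --> \oo] -->
  pi * fine (P0 [set w | X0 w <= a]).
Proof.
have mB : measurable [set w | X0 w <= a].
  have := measurable_funPT X0 measurableT _ (measurable_itv `]-oo, a]).
  by rewrite setTI; congr (measurable _); apply/seteqP; split => w /=; rewrite in_itv.
have mI : measurable_fun setT (\1_[set w | X0 w <= a] : T0 -> R).
  exact: measurable_indic.
have iI : P0.-integrable setT (EFin \o (\1_[set w | X0 w <= a] : T0 -> R)).
  apply: (@bounded_RV_integrable _ _ _ _ _ 1) => [//|w].
  by rewrite indicE; case: (_ \in _); rewrite ?normr1 ?normr0.
have -> : pi * fine (P0 [set w | X0 w <= a]) =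
    \int[P0]_w (pi * \1_[set w | X0 w <= a] w).
  by rewrite (RintegralZl _ _ iI) // /Rintegral integral_indic // setIT.
apply: (bounded_cvg_expectation (M := pi)).
- move=> n; have := @atan_diff_integrable _ _ _ P0 X0 (sgn n) (a + n.+1%:R^-1) (- n.+1%:R).
  by case/integrableP => /measurable_EFinP.
- exact: measurable_funM.
- move=> n w; apply: le_trans (ler_normB _ _) _; rewrite [leRHS]splitr.
  by rewrite lerD // atan_bounds.
- move=> w; rewrite indicE (_ : (w \in _) = (X0 w <= a)); first exact: dA_cvg.
  by apply/idP/idP; rewrite inE.
Qed.

(** The bound on arctangent differences is uniform in the scale, so the scale can tend to 0 and
    leaves no smoothing error. *)
Lemma Kolmogorov_smoothing a :
  `|fine (P [set w | X w <= a]) - fine (Q [set w | Y w <= a])| <= D.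
Proof.
pose u n := \int[P]_w dA (sgn n) (a + n.+1%:R^-1) (- n.+1%:R) (X w) -
  \int[Q]_w dA (sgn n) (a + n.+1%:R^-1) (- n.+1%:R) (Y w).
have PQ : `|u n| @[n --> \oo] -->
    `|pi * fine (P [set w | X w <= a]) - pi * fine (Q [set w | Y w <= a])|.
  by apply: cvg_norm; apply: cvgB; [exact: (@cdf_cvg _ _ P X a)|exact: (@cdf_cvg _ _ Q Y a)].
have : `|pi * fine (P [set w | X w <= a]) - pi * fine (Q [set w | Y w <= a])| <= 2 * D.
  apply: cvgr_to_le PQ _; have := near_nat (- a); apply: filterS => n na /=.
  apply: atan_diff_le; first by rewrite invr_gt0 exprn_gt0.
  have i0 : 0 <= n.+1%:R^-1 :> R by rewrite invr_ge0.
  by move: na i0; move: (n.+1%:R) (n.+1%:R^-1) => y z; lra.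
rewrite -mulrBr normrM ger0_norm ?pi_ge0 // => piD.
(* The factor 2 is absorbed by [pi >= 2]. *)
rewrite -(ler_pM2l (_ : 0 < 2 :> R)) //; apply: le_trans piD.
by rewrite ler_wpM2r // pi_ge2.
Qed.

End smoothing.

(** * Bounds for the stable laws *)

(** With [w = s^alpha / 2], the inequality [(w / n)^n <= exp w] lets the exponential absorb any
    power of [s]. *)
Lemma exp_power_bounded (R : realType) (alpha p : R) :
  0 < alpha -> 0 < p ->
  exists2 K : R, 0 < K & forall s, 0 < s ->
    (1 + s `^ p) ^+ 2 * expR (- (s `^ alpha / 2)) <= K.
Proof.
move=> al0 p0.
(* Large enough that [2 p <= alpha n], whence [s^(2 p) <= 1 + s^(alpha n)]. *)
pose n := (Num.truncn (2 * p / alpha)).+1.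
have nP : 2 * p <= alpha * n%:R.
  by rewrite [leRHS]mulrC -ler_pdivrMr // /n ltW // truncnS_gt.
have pow_exp (w : R) : 0 <= w -> (w / n%:R) ^+ n <= expR w.
  move=> w0; have {2}-> : w = n%:R * (w / n%:R) by rewrite mulrC divfK // pnatr_eq0.
  rewrite expRM_natl lerXn2r ?nnegrE ?divr_ge0 ?expR_ge0 //.
  by apply: le_trans (expR_ge1Dx _); rewrite lerDr.
(* The square is at most [2 + 2 s^(2 p) <= 4 + 2 (2 n)^n exp w]; multiplying by [exp (- w) <= 1]
   leaves this constant. *)
exists (4 + 2 * (2 * n%:R) ^+ n) => [|s s0].
  by rewrite ltr_wpDr // mulr_ge0 // exprn_ge0 // mulr_ge0.
have spge0 : 0 <= s `^ p := powR_ge0 _ _.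
have sq : (1 + s `^ p) ^+ 2 <= 2 + 2 * s `^ (2 * p).
  rewrite (mulrC 2 p) powRrM powR_mulrn ?powR_ge0 //.
  by have := sqr_ge0 (1 - s `^ p); rewrite !expr2; lra.
have s2p : s `^ (2 * p) <= 1 + s `^ (alpha * n%:R).
  case: (leP 1 s) => s1.
    by apply: le_trans (ler_powR s1 nP) _; rewrite lerDr.
  apply: (@le_trans _ _ 1); last by rewrite lerDl powR_ge0.
  by rewrite -[leRHS](powRr0 s); apply: ger_powR; [rewrite s0 ltW|rewrite mulr_ge0 // ltW].
have sn : s `^ (alpha * n%:R) = (2 * n%:R) ^+ n * (s `^ alpha / 2 / n%:R) ^+ n.
  rewrite powRrM powR_mulrn ?powR_ge0 // -exprMn; congr (_ ^+ _).
  by field; rewrite pnatr_eq0.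
set w := s `^ alpha / 2 in sn *.
have w0 : 0 <= w by rewrite divr_ge0 // powR_ge0.
have e0 : expR (- w) <= 1 by rewrite -expR0 ler_expR oppr_le0.
have en := pow_exp _ w0.
set B := (2 * n%:R) ^+ n in sn *.
have B0 : 0 <= B by rewrite exprn_ge0 // mulr_ge0.
have s2p' : s `^ (2 * p) <= 1 + B * expR w.
  by apply: le_trans s2p _; rewrite lerD2l sn ler_wpM2l.
apply: (@le_trans _ _ ((4 + 2 * B * expR w) * expR (- w))).
  by rewrite ler_wpM2r ?expR_ge0 //; lra.
rewrite mulrDl -mulrA expRxMexpNx_1 mulr1 lerD2r.
by lra.
Qed.

Lemma continuous_powR_scale (R : realType) (c r z : R) :
  0 < c * z -> {for z, continuous (fun y => (c * y) `^ r)}.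
Proof.
move=> cz0; apply: (@continuous_comp _ _ _ ( *%R c) (fun y => y `^ r)).
  exact: mulrl_continuous.
apply: differentiable_continuous; apply/derivable1_diffP.
by apply: derivable_powR; rewrite in_itv /= andbT.
Qed.

(** The primitive [- 1 / (p (1 + (c z)^p))] takes values between [- 1 / p] and 0, so the bound
    depends neither on [c] nor on the segment. *)
Lemma powR_tail_integral (R : realType) (c p a b : R) :
  0 < c -> 0 < p -> 0 < a -> a < b ->
  \int[lebesgue_measure]_(z in `[a, b])
    (c * (c * z) `^ (p - 1) / (1 + (c * z) `^ p) ^+ 2) <= p^-1.
Proof.
move=> c0 p0 a0 ab.
have pos (z : R) : a <= z <= b -> 0 < z by move=> /andP[/(lt_le_trans a0)].
have dpow (q z : R) : 0 < z -> is_derive z 1 (fun z => (c * z) `^ q)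
    (c * q * (c * z) `^ (q - 1)).
  move=> z0; have cz0 : 0 < c * z by rewrite mulr_gt0.
  have H1 : is_derive (c * z) 1 (fun y => y `^ q) (q * (c * z) `^ (q - 1)).
    apply: DeriveDef; first by apply: derivable_powR; rewrite in_itv /= andbT.
    by rewrite -derive1E powR_derive1 // in_itv /= andbT.
  have H2 : is_derive z 1 ( *%R c) c.
    by apply: is_derive_eq; rewrite /GRing.scale /=; ring.
  have := @is_derive1_comp _ (fun x => x `^ q) ( *%R c) z _ _ H1 H2.
  by move=> H; apply: is_derive_eq H _; ring.
have den (z : R) : 1 + (c * z) `^ p != 0.
  by rewrite gt_eqF // ltr_wpDr // powR_ge0.
pose F (z : R) := - (p^-1 * (1 + (c * z) `^ p)^-1).
pose f (z : R) := c * (c * z) `^ (p - 1) / (1 + (c * z) `^ p) ^+ 2.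
have cf (z : R) : a <= z <= b -> {for z, continuous f}.
  move=> /pos z0.
  have cp (q : R) : {for z, continuous (fun z => (c * z) `^ q)}.
    by apply: continuous_powR_scale; rewrite mulr_gt0.
  apply: cvgM.
    by apply: cvgM; [exact: cvg_cst|exact: cp].
  apply: cvgV; first by rewrite expf_neq0.
  by apply: cvgM; apply: cvgD; [exact: cvg_cst|exact: cp|exact: cvg_cst|exact: cp].
have dF (z : R) : a <= z <= b -> is_derive z 1 F (f z).
  move=> /pos z0.
  have H := dpow p z z0.
  have D := den z.
  rewrite /F; apply: is_derive_eq.
  rewrite /GRing.scale /= /f; field.
  by rewrite D gt_eqF.
rewrite (Rintegral_FTC ab cf dF) /F opprK addrC.
rewrite -mulrBr ler_piMr ?invr_ge0 ?(ltW p0) // lerBlDr -[leLHS]addr0 lerD //.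
  by rewrite invf_le1 ?lerDl ?powR_ge0 // ltr_wpDr // powR_ge0.
by rewrite invr_ge0 addr_ge0 // powR_ge0.
Qed.

(** The leading [c] is the Jacobian of [s = c xi]: over all positive frequencies the integral is
    that of [s^q exp (- s^alpha / 2)], independent of [c], and finite for [alpha > 0] and
    [q > -1]. *)
Definition stable_majorant (R : realType) (c alpha q xi : R) : R :=
  c * (c * xi) `^ q * expR (- ((c * xi) `^ alpha / 2)).

Lemma stable_majorant_integrable (R : realType) (c alpha q a b : R) :
  0 < c -> 0 < a -> a < b ->
  (@lebesgue_measure R).-integrable `[a, b] (EFin \o stable_majorant c alpha q).
Proof.
move=> c0 a0 ab; apply: continuous_compact_integrable; first exact: segment_compact.
apply: continuous_in_subspaceT => z; rewrite inE /= in_itv /= => /andP[az _].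
have cz0 : 0 < c * z by rewrite mulr_gt0 // (lt_le_trans a0).
have cp (r : R) : {for z, continuous (fun z => (c * z) `^ r)}.
  exact: continuous_powR_scale.
apply: cvgM.
  by apply: cvgM; [exact: cvg_cst|exact: cp].
apply: (@continuous_comp _ _ _ (fun z => - ((c * z) `^ alpha / 2)) expR).
  by apply: cvgN; apply: cvgM; [exact: cp|exact: cvg_cst].
exact: continuous_expR.
Qed.

Lemma stable_majorant_integral (R : realType) (alpha q : R) :
  0 < alpha -> -1 < q -> exists2 K : R, 0 <= K &
  forall c a b, 0 < c -> 0 < a -> a < b ->
    \int[lebesgue_measure]_(xi in `[a, b]) stable_majorant c alpha q xi <= K.
Proof.
move=> al0 q1; have p0 : 0 < q + 1 by lra.
have [K K0 HK] := exp_power_bounded al0 p0.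
(* [s^q exp (- s^alpha / 2)] is dominated by [K s^(p - 1) / (1 + s^p)^2] with
   [p = q + 1], whose primitive [- 1 / (p (1 + s^p))] is explicit. *)
exists (K * (q + 1)^-1) => [|c a b c0 a0 ab].
  by rewrite mulr_ge0 ?invr_ge0 ?(ltW K0) ?(ltW p0).
pose f (z : R) := c * (c * z) `^ (q + 1 - 1) / (1 + (c * z) `^ (q + 1)) ^+ 2.
have den (z : R) : 0 < (1 + (c * z) `^ (q + 1)) ^+ 2.
  by rewrite exprn_gt0 // ltr_wpDr // powR_ge0.
have fi : (@lebesgue_measure R).-integrable `[a, b] (EFin \o f).
  apply: continuous_compact_integrable; first exact: segment_compact.
  apply: continuous_in_subspaceT => z; rewrite inE /= in_itv /= => /andP[az _].
  have cz0 : 0 < c * z by rewrite mulr_gt0 // (lt_le_trans a0).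
  have cp (r : R) : {for z, continuous (fun z => (c * z) `^ r)}.
    exact: continuous_powR_scale.
  apply: cvgM.
    by apply: cvgM; [exact: cvg_cst|exact: cp].
  apply: cvgV; first by rewrite gt_eqF.
  by apply: cvgM; apply: cvgD; [exact: cvg_cst|exact: cp|exact: cvg_cst|exact: cp].
apply: (@le_trans _ _ (\int[lebesgue_measure]_(z in `[a, b]) (K * f z))); last first.
  rewrite RintegralZl // ler_wpM2l ?(ltW K0) //; exact: powR_tail_integral.
apply: le_Rintegral => //.
- exact: stable_majorant_integrable.
- by have := @integrableZl _ _ _ (@lebesgue_measure R) _ (measurable_itv _) K _ fi.
move=> z; rewrite /= in_itv /= => /andP[az _].
have cz0 : 0 < c * z by rewrite mulr_gt0 // (lt_le_trans a0).
rewrite /stable_majorant /f addrK mulrCA ler_wpM2l ?mulr_ge0 ?powR_ge0 ?(ltW c0) //.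
rewrite ler_pdivlMr // mulrC.
exact: HK.
Qed.

Lemma cexpD (R : realType) (z w : R[i]) : cexp (z + w) = cexp z * cexp w.
Proof.
case: z w => [a b] [a' b']; rewrite /cexp /= expRD cosD sinD.
by apply/eqP; rewrite eq_complex /=; apply/andP; split; apply/eqP; ring.
Qed.

Lemma cexp_cis (R : realType) (y : R) : cis y = cexp (0 +i* y).
Proof. by rewrite /cexp /cis /= expR0 !mul1r. Qed.

(** Moduli are compared by [1 - exp (- u) <= u], phases by the Lipschitz bounds of [cos] and [sin].
    The factor [exp (- p')] is kept because its decay makes the frequency integrals converge. *)
Lemma cexp_lip (R : realType) (p p' q q' : R) : p' <= p ->
  `|complex.Re (cexp (- p' +i* q')) - complex.Re (cexp (- p +i* q))| +
  `|complex.Im (cexp (- p' +i* q')) - complex.Im (cexp (- p +i* q))| <=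
  2 * (expR (- p') * (p - p' + `|q' - q|)).
Proof.
move=> pp'; set e := expR (- p'); have e0 : 0 <= e by exact: expR_ge0.
have ee : 0 <= e - expR (- p) <= e * (p - p').
  rewrite subr_ge0 ler_expR lerN2 pp' /=.
  have -> : expR (- p) = e * expR (p' - p) by rewrite -expRD; congr expR; ring.
  rewrite (_ : _ - _ = e * (1 - expR (p' - p))); last by ring.
  by rewrite ler_wpM2l //; have := expR_ge1Dx (p' - p); lra.
have aux (f : R -> R) : `|f q' - f q| <= `|q' - q| -> `|f q| <= 1 ->
    `|e * f q' - expR (- p) * f q| <= e * (p - p' + `|q' - q|).
  move=> fl f1; rewrite (_ : _ - _ = (e - expR (- p)) * f q + e * (f q' - f q)); last by ring.
  apply: le_trans (ler_normD _ _) _; rewrite [leRHS]mulrDr lerD // normrM.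
    have /andP[ee0 ee1] := ee; apply: le_trans ee1.
    by rewrite ger0_norm // ler_piMr.
  by rewrite ger0_norm // ler_wpM2l.
rewrite mulr_natl mulr2n /cexp /= lerD // aux ?cos_lip ?sin_lip ?cos_max ?sin_max //.
Qed.

Lemma stable_exponent_gt0 (R : realType) (c alpha beta xi : R) : 0 < c -> 0 < xi ->
  stable_exponent c alpha beta xi =
  (- (c * xi) `^ alpha) +i* ((c * xi) `^ alpha * (beta * stable_h alpha xi)).
Proof.
move=> c0 xi0; rewrite /stable_exponent ger0_norm ?mulr_ge0 ?ltW // gtr0_sg // mulr1.
by apply/eqP; rewrite eq_complex /=; apply/andP; split; apply/eqP; ring.
Qed.

(* The hypothesis relating [X] and [Y] says that the characteristic function of
   [X - b x] is the cofactor of [phi (b xi)] in the self-decomposition of the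
   law of [Y]. *)
Lemma stable_ecf_diff (R : realType) (d d' : measure_display) (T : measurableType d)
    (T' : measurableType d') (P : probability T R) (Q : probability T' R)
    (X : {mfun T >-> R}) (Y : {mfun T' >-> R}) (c alpha beta b x xi : R) :
  0 < c -> 0 < b -> b `^ alpha <= 1 / 2 ->
  (forall y, ecf P X y * ecf Q Y (y * b) = cis (y * (b * x)) * ecf Q Y y) ->
  (forall y, ecf Q Y y = cexp (stable_exponent c alpha beta y)) -> 0 < xi ->
  `|complex.Re (ecf P X xi) - complex.Re (ecf Q Y xi)| +
  `|complex.Im (ecf P X xi) - complex.Im (ecf Q Y xi)| <=
  2 * (expR (- ((c * xi) `^ alpha / 2)) *
       ((c * xi) `^ alpha * b `^ alpha * (1 + `|beta * stable_h alpha (xi * b)|) +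
        xi * b * `|x|)).
Proof.
move=> c0 b0 bal XY stY xi0.
have xib0 : 0 < xi * b by rewrite mulr_gt0.
pose p := (c * xi) `^ alpha.
have pb : (c * (xi * b)) `^ alpha = p * b `^ alpha.
  by rewrite mulrA powRM ?(ltW b0) // mulr_ge0 // ltW.
have p_ge0 : 0 <= p := powR_ge0 _ _.
have b_ge0 : 0 <= b `^ alpha := powR_ge0 _ _.
pose q := p * (beta * stable_h alpha xi).
pose qb := p * b `^ alpha * (beta * stable_h alpha (xi * b)).
have Eb : stable_exponent c alpha beta (xi * b) = (- (p * b `^ alpha)) +i* qb.
  by rewrite stable_exponent_gt0 // pb.
have E : stable_exponent c alpha beta xi = (- p) +i* q by rewrite stable_exponent_gt0.
(* [- p' +i* q'] is the exponent of the characteristic function of [X]: that of [Y] at [xi], minus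
   its value at [xi * b], plus the shift. *)
pose p' := p - p * b `^ alpha.
pose q' := xi * (b * x) + q - qb.
have YE : ecf Q Y xi = cexp (- p +i* q) by rewrite stY E.
have XE : ecf P X xi = cexp (- p' +i* q').
  have := XY xi; rewrite !stY E Eb cexp_cis -cexpD => XYxi.
  rewrite -[LHS]mulr1 (_ : 1 = cexp (- (p * b `^ alpha) +i* qb) *
    cexp ((p * b `^ alpha) +i* (- qb))); last first.
    by rewrite -cexpD /cexp /= addNr subrr expR0 cos0 sin0 !mul1r.
  rewrite mulrA XYxi -cexpD; congr cexp.
  by apply/eqP; rewrite eq_complex /= /p' /q'; apply/andP; split; apply/eqP; ring.
have p'p : p' <= p by rewrite lerBlDr lerDl mulr_ge0.
rewrite XE YE; apply: le_trans (cexp_lip q q' p'p) _.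
rewrite ler_wpM2l //; apply: ler_pM.
- exact: expR_ge0.
- by rewrite addr_ge0 // subr_ge0.
(* Since [b^alpha <= 1 / 2], at least half of the decay remains: [p' >= p / 2]. *)
- rewrite ler_expR lerN2 /p' -/p.
  have : p * b `^ alpha <= p * (1 / 2) by rewrite ler_wpM2l.
  lra.
rewrite -/p (_ : p - p' = p * b `^ alpha); last by rewrite /p'; ring.
rewrite (_ : q' - q = xi * b * x - qb); last by rewrite /q'; ring.
apply: (@le_trans _ _ (p * b `^ alpha + (`|xi * b * x| + `|qb|))).
  by rewrite lerD2l ler_normB.
rewrite [`|qb|]normrM (ger0_norm (_ : 0 <= p * b `^ alpha)) ?mulr_ge0 //.
by rewrite normrM (gtr0_norm xib0); lra.
Qed.

(** The first term serves large [s]; near 0, [- ln s] is [2 ln (s^(-1/2))]. The exponent [-1/2]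
    exceeds [-1], so the corresponding majorant stays integrable at 0. *)
Lemma ln_norm_le (R : realType) (s : R) : 0 < s -> `|ln s| <= s + 2 * s `^ (- (1 / 2)).
Proof.
move=> s0; have sp : 0 < s `^ (- (1 / 2)) by exact: powR_gt0.
have h1 := ln_sublinear s0; have h2 := ln_sublinear sp.
by move: h2; rewrite ln_powR ler_norml => h2; apply/andP; split; lra.
Qed.

(** * Kolmogorov distance to a stable law *)

Section Kolmogorov_stable.
Context (R : realType) (d d' : measure_display) (T : measurableType d)
  (T' : measurableType d') (P : probability T R) (Q : probability T' R)
  (X : {RV P >-> R}) (Y : {RV Q >-> R}).

(** Esseen's inequality with a combination of three majorants, as many as the logarithm at
    [alpha = 1] produces. *)
Lemma Kolmogorov_majorant (c alpha q0 q1 q2 k0 k1 k2 K0 K1 K2 : R) :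
  0 < c -> 0 <= k0 -> 0 <= k1 -> 0 <= k2 ->
  (forall a b, 0 < a -> a < b ->
     \int[lebesgue_measure]_(z in `[a, b]) stable_majorant c alpha q0 z <= K0) ->
  (forall a b, 0 < a -> a < b ->
     \int[lebesgue_measure]_(z in `[a, b]) stable_majorant c alpha q1 z <= K1) ->
  (forall a b, 0 < a -> a < b ->
     \int[lebesgue_measure]_(z in `[a, b]) stable_majorant c alpha q2 z <= K2) ->
  (forall xi, 0 < xi ->
     `|complex.Re (ecf P X xi) - complex.Re (ecf Q Y xi)| +
     `|complex.Im (ecf P X xi) - complex.Im (ecf Q Y xi)| <=
     xi * (k0 * stable_majorant c alpha q0 xi + k1 * stable_majorant c alpha q1 xi +
           k2 * stable_majorant c alpha q2 xi)) ->
  Kolmogorov_dist X Y <= k0 * K0 + k1 * K1 + k2 * K2.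
Proof.
move=> c0 k00 k10 k20 H0 H1 H2 XY.
have im (q a b : R) : 0 < a -> a < b ->
    (@lebesgue_measure R).-integrable `[a, b] (EFin \o stable_majorant c alpha q).
  exact: stable_majorant_integrable.
have imZ (k q a b : R) : 0 < a -> a < b -> (@lebesgue_measure R).-integrable `[a, b]
    (EFin \o (fun z => k * stable_majorant c alpha q z)).
  move=> a0 ab.
  by have := @integrableZl _ _ _ (@lebesgue_measure R) _ (measurable_itv _) k _ (im q a b a0 ab).
have imD (a b : R) : 0 < a -> a < b -> (@lebesgue_measure R).-integrable `[a, b]
    (EFin \o (fun z => k0 * stable_majorant c alpha q0 z + k1 * stable_majorant c alpha q1 z)).
  move=> a0 ab.
  by have := @integrableD _ _ _ (@lebesgue_measure R) _ (measurable_itv _) _ _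
    (imZ k0 q0 a b a0 ab) (imZ k1 q1 a b a0 ab).
apply: ge_sup; first by exists (`|fine (P [set w | X w <= 0]) - fine (Q [set w | Y w <= 0])|), 0.
move=> _ [a _ <-].
apply: (Kolmogorov_smoothing _ _ XY) => {}a b a0 ab.
  by have := @integrableD _ _ _ (@lebesgue_measure R) _ (measurable_itv _) _ _
    (imD a b a0 ab) (imZ k2 q2 a b a0 ab).
rewrite RintegralD //; [|exact: imD|exact: imZ].
rewrite RintegralD //; [|exact: imZ|exact: imZ].
rewrite !RintegralZl //; try exact: im.
by rewrite !lerD // ler_wpM2l //; [exact: H0|exact: H1|exact: H2].
Qed.

Variables (c alpha beta b x : R).
Hypotheses (c0 : 0 < c) (b0 : 0 < b) (b_small : b `^ alpha <= 1 / 2).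
Hypothesis XY : forall y, ecf P X y * ecf Q Y (y * b) = cis (y * (b * x)) * ecf Q Y y.
Hypothesis stY : forall y, ecf Q Y y = cexp (stable_exponent c alpha beta y).

(** The shift [xi b |x|] yields the majorant of exponent 0 with weight [b |x| / c], and the stable
    exponent at [b xi] the one of exponent [alpha - 1]. *)
Lemma Kolmogorov_stable_bounded_skew (tau K0 K1 : R) :
  0 < alpha -> 0 <= tau ->
  (forall y, 0 < y -> `|beta * stable_h alpha y| <= tau) ->
  (forall a b, 0 < a -> a < b ->
     \int[lebesgue_measure]_(z in `[a, b]) stable_majorant c alpha 0 z <= K0) ->
  (forall a b, 0 < a -> a < b ->
     \int[lebesgue_measure]_(z in `[a, b]) stable_majorant c alpha (alpha - 1) z <= K1) ->
  Kolmogorov_dist X Y <= 2 * (b * (`|x| / c)) * K0 + 2 * (b `^ alpha * (1 + tau)) * K1.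
Proof.
move=> al0 tau0 skew H0 H1; rewrite -[leRHS]addr0 -[X in _ + X](mul0r K0).
apply: (Kolmogorov_majorant (c := c) (alpha := alpha) (q0 := 0) (q1 := alpha - 1) (q2 := 0)) => //.
- by rewrite !mulr_ge0 ?invr_ge0 ?(ltW b0) ?(ltW c0).
- by rewrite !mulr_ge0 ?powR_ge0 ?addr_ge0.
move=> xi xi0; apply: le_trans (stable_ecf_diff c0 b0 b_small XY stY xi0) _.
rewrite /stable_majorant powRr0; set e := expR _.
have s0 : 0 <= c * xi by rewrite mulr_ge0 // ltW.
rewrite -(mulr_powRB1 s0 al0); set s := (c * xi) `^ (alpha - 1).
have s_ge0 : 0 <= s := powR_ge0 _ _.
rewrite (_ : xi * _ = 2 * (e * (c * xi * s * b `^ alpha * (1 + tau) + xi * b * `|x|))); last first.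
  by field; rewrite gt_eqF.
have e0 : 0 <= e by exact: expR_ge0.
rewrite ler_wpM2l // ler_wpM2l // lerD2r ler_wpM2l ?lerD2l ?skew ?mulr_gt0 //.
by rewrite mulr_ge0 ?powR_ge0 // mulr_ge0.
Qed.

(** Writing [ln (xi b) = ln (c xi) - ln c - r] isolates [r], the source of the extra factor [v t] in
    the rate. By [ln_norm_le], [ln (c xi)] yields the majorants of exponents 1 and [-1/2]; the
    remaining terms have exponent 0. *)
Lemma Kolmogorov_Cauchy_skew (r K0 K1 K2 : R) :
  alpha = 1 -> `|beta| <= 1 -> b = expR (- r) -> 0 <= r ->
  (forall a b, 0 < a -> a < b ->
     \int[lebesgue_measure]_(z in `[a, b]) stable_majorant c 1 0 z <= K0) ->
  (forall a b, 0 < a -> a < b ->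
     \int[lebesgue_measure]_(z in `[a, b]) stable_majorant c 1 1 z <= K1) ->
  (forall a b, 0 < a -> a < b ->
     \int[lebesgue_measure]_(z in `[a, b]) stable_majorant c 1 (- (1 / 2)) z <= K2) ->
  Kolmogorov_dist X Y <=
    2 * b * (`|x| / c + 1 + `|ln c| + r) * K0 + 2 * b * K1 + 4 * b * K2.
Proof.
move=> al1 beta1 br r0 H0 H1 H2.
apply: (Kolmogorov_majorant (c := c) (alpha := 1) (q0 := 0) (q1 := 1) (q2 := - (1 / 2))) => //.
- by rewrite !mulr_ge0 ?(ltW b0) // !addr_ge0 // mulr_ge0 // invr_ge0 ltW.
- by rewrite mulr_ge0 // ltW.
- by rewrite mulr_ge0 // ltW.
move=> xi xi0.
have := stable_ecf_diff c0 b0 b_small XY stY xi0; rewrite al1 => /le_trans; apply.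
have s0 : 0 < c * xi by rewrite mulr_gt0.
rewrite /stable_majorant powRr0 !powRr1 ?(ltW s0) ?(ltW b0) //; set e := expR _.
have e0 : 0 <= e by exact: expR_ge0.
have lns := ln_norm_le s0.
have skew : `|beta * stable_h 1 (xi * b)| <=
    c * xi + 2 * (c * xi) `^ (- (1 / 2)) + `|ln c| + r.
  have lnE : ln `|xi * b| = ln (c * xi) - ln c - r.
    have lnb : ln b = - r by rewrite br expRK.
    have lnxb : ln (xi * b) = ln xi + ln b by rewrite lnM ?posrE.
    have lncx : ln (c * xi) = ln c + ln xi by rewrite lnM ?posrE.
    by rewrite gtr0_norm ?mulr_gt0 // lnxb lncx lnb; ring.
  rewrite /stable_h eqxx lnE normrM -[leRHS]mul1r ler_pM // normrM.
  rewrite -[leRHS]mul1r ler_pM //.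
    rewrite normrN ger0_norm ?divr_ge0 ?pi_ge0 //.
    by rewrite ler_pdivrMr ?pi_gt0 // mul1r pi_ge2.
  apply: le_trans (ler_normB _ _) _; rewrite (ger0_norm r0) lerD2r.
  by apply: le_trans (ler_normB _ _) _; rewrite lerD2r.
set w := (c * xi) `^ (- (1 / 2)) in skew *.
rewrite (_ : xi * _ = 2 * (e * (c * xi * b *
    (1 + (c * xi + 2 * w + `|ln c| + r)) + xi * b * `|x|))); last first.
  by field; rewrite gt_eqF.
rewrite ler_wpM2l // ler_wpM2l // lerD2r ler_wpM2l ?lerD2l //.
by rewrite mulr_ge0 // ltW.
Qed.

End Kolmogorov_stable.

(** The [O] is read for [v t >= t0], with [C] fixed before [c], [beta] and [v]. Dividing by [c]
    turns the starting point into [x / c], so where the contribution of [x] has the order of the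
    rate the constant is taken at [x / c]; elsewhere that contribution vanishes or, being of lower
    order, is absorbed beyond [t0]. *)
Theorem proposition25 (R : realType) :
  exists C : R -> R -> R,
  forall c alpha x : R, 0 < c -> 0 < alpha <= 2 ->
  exists t0 : R,
  forall (beta v : R), -1 <= beta <= 1 -> 0 < v ->
  forall (dY : measure_display) (TY : measurableType dY)
         (Q : probability TY R) (Y : {RV Q >-> R}),
    stable_law c alpha beta (distribution Q Y) ->
  forall tau : triplet R,
    corresponding_triplet v (distribution Q Y) tau ->
  forall (d : measure_display) (T : measurableType d)
         (P : probability T R) (U : R -> {RV P >-> R}),
    Ornstein_Uhlenbeck tau v x U ->
  forall t : R, 0 <= t -> t0 <= v * t ->
    [/\ 1 < alpha -> x != 0 ->
          Kolmogorov_dist (U t) Y <= C (x / c) alpha * expR (- (v * t)),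
        alpha < 1 ->
          Kolmogorov_dist (U t) Y <= C x alpha * expR (- (alpha * v * t)),
        alpha = 1 -> beta = 0 ->
          Kolmogorov_dist (U t) Y <= C (x / c) alpha * expR (- (alpha * v * t)),
        1 < alpha -> x = 0 ->
          Kolmogorov_dist (U t) Y <= C x alpha * expR (- (alpha * v * t)) &
        alpha = 1 -> beta != 0 ->
          Kolmogorov_dist (U t) Y <= C x alpha * (v * t * expR (- (v * t)))].
Proof.
(* The constants are chosen as a function of [(alpha, q)], ahead of [c]; outside the admissible
   range the value 0 is a placeholder. *)
have /choice[K HK] : forall aq : R * R, exists k : R, 0 < aq.1 -> -1 < aq.2 ->
    0 <= k /\ forall c a b, 0 < c -> 0 < a -> a < b ->
      \int[lebesgue_measure]_(z in `[a, b]) stable_majorant c aq.1 aq.2 z <= k.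
  move=> [al q] /=; case: (ltP 0 al) => [al0|]; last by exists 0.
  case: (ltP (-1) q) => [q1|]; last by exists 0.
  by have [k k0 Hk] := stable_majorant_integral al0 q1; exists k.
pose tau (al : R) : R := `|tan (pi * al / 2)|.
(* One constant for all cases: [|y| + 1] dominates the weights [|x| / c], 1 and 0 given to the
   shift, while 8, 2 and 4 come from [Kolmogorov_Cauchy_skew] once its bracket is at most
   [4 v t]. *)
pose C (y al : R) : R := 2 * (K (al, 0%R) * (`|y| + 1) + (1 + tau al) * K (al, al - 1)) +
  (8 * K (1, 0%R) + 2 * K (1, 1) + 4 * K (1, - (1 / 2))).
exists C => c alpha x c0 /andP[al0 al2].
have ali0 : 0 <= alpha^-1 by rewrite invr_ge0 ltW.
have xc0 : 0 <= `|x| / c by rewrite divr_ge0 // ltW.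
have xca0 : 0 <= `|x| / c / `|1 - alpha| by rewrite divr_ge0.
(* The first term makes [b^alpha <= 1/2]; the others let [v t] absorb the terms
   of lower order, the last one giving [b |x| / c <= b^alpha] when [alpha < 1]
   (at [alpha = 1] it is 0). *)
exists (alpha^-1 + 1 + `|x| / c + `|ln c| + `|x| / c / `|1 - alpha|).
move=> beta v /andP[beta1 beta2] v0 dY TY Q Y stY tri [_ _ law] d T P U OU t t_ge0 t0vt.
have lnc0 : 0 <= `|ln c| by [].
have [vt1 [xc_vt [lnc_vt [xca_vt ali_vt]]]] : 1 <= v * t /\ `|x| / c <= v * t /\
    `|ln c| <= v * t /\ `|x| / c / `|1 - alpha| <= v * t /\ alpha^-1 <= v * t.
  by move: t0vt ali0 xc0 xca0 lnc0; clear; move=> *; do ?split; lra.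
clear t0vt.
have t0 : 0 < t by rewrite -(pmulr_rgt0 _ v0) (lt_le_trans ltr01 vt1).
have avt : 1 <= alpha * (v * t).
  by rewrite mulrC -ler_pdivrMr // mul1r.
pose b := expR (- (v * t)).
have b0 : 0 < b by exact: expR_gt0.
have bal : b `^ alpha = expR (- (alpha * v * t)).
  by rewrite /b -expRM; congr expR; ring.
have b_small : b `^ alpha <= 1 / 2.
  rewrite bal expRN mul1r lef_pV2 ?posrE ?expR_gt0 //.
  by apply: le_trans (expR_ge1Dx _); rewrite -mulrA; lra.
have XY (y : R) : ecf P (U t) y * ecf Q Y (y * b) = cis (y * (b * x)) * ecf Q Y y.
  have [Z LZ UZ] := OU.
  by have := OU_flow LZ UZ t0 v0 y (law _ _ _ _ _ OU); rewrite !charfun_distribution.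
have stYe (y : R) : ecf Q Y y = cexp (stable_exponent c alpha beta y).
  by rewrite -charfun_distribution.
have beta_le1 : `|beta| <= 1 by rewrite ler_norml beta1.
have [K00 HK0] := HK (alpha, 0) al0 (ltrN10 R).
have am1 : -1 < alpha - 1 by lra.
have [K10 HK1] := HK (alpha, alpha - 1) al0 am1.
have [K100 HK100] := HK (1, 0) ltr01 (ltrN10 R).
have N11 : (-1 : R) < 1 by lra.
have Nh1 : (-1 : R) < - (1 / 2) by lra.
have [K110 HK110] := HK (1, 1) ltr01 N11.
have [K1h0 HK1h] := HK (1, - (1 / 2)) ltr01 Nh1.
have tau0 : 0 <= tau alpha by exact: normr_ge0.
have bounded_skew : (alpha == 1) ==> (beta == 0) ->
    Kolmogorov_dist (U t) Y <= 2 * (b * (`|x| / c)) * K (alpha, 0) +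
      2 * (b `^ alpha * (1 + tau alpha)) * K (alpha, alpha - 1).
  move=> ab; apply: (Kolmogorov_stable_bounded_skew c0 b0 b_small XY stYe) => //.
  - move=> y _; rewrite /stable_h; case: eqP ab => [_ /= /eqP -> | _ _].
      by rewrite mul0r normr0.
    by rewrite normrM -[leRHS]mul1r ler_pM.
  - by move=> a' b'; exact: HK0.
  - by move=> a' b'; exact: HK1.
(* [z] is the weight of the shift term once the rate is factored out; each use refutes the second
   alternative. *)
have C_ge (y z : R) : 0 <= z -> 2 * (K (alpha, 0) * z + (1 + tau alpha) * K (alpha, alpha - 1)) <=
    C y alpha \/ `|y| + 1 < z.
  move=> z0; case: (ltP (`|y| + 1) z) => zy; [by right|left].
  by move: (ler_wpM2l K00 zy) K100 K110 K1h0; rewrite /C; clear; lra.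
have normxc : `|x / c| = `|x| / c by rewrite normrM normfV (gtr0_norm c0).
split.
- move=> al1 _; apply: le_trans (bounded_skew _) _; first by rewrite gt_eqF.
  have bb : b `^ alpha <= b.
    rewrite -[leRHS](powRr1 (ltW b0)); apply: ger_powR; last exact: ltW.
    by rewrite b0 expR_le1 oppr_le0 (le_trans ler01).
  have [Cle|] := C_ge (x / c) (`|x| / c) xc0; last by rewrite normxc; clear; lra.
  apply: (@le_trans _ _ (2 * (K (alpha, 0) * (`|x| / c) +
    (1 + tau alpha) * K (alpha, alpha - 1)) * b)); last by rewrite ler_wpM2r // ltW.
  have : b `^ alpha * ((1 + tau alpha) * K (alpha, alpha - 1)) <=
    b * ((1 + tau alpha) * K (alpha, alpha - 1)) by rewrite ler_wpM2r // mulr_ge0 // addr_ge0.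
  by clear; lra.
- move=> al1; apply: le_trans (bounded_skew _) _; first by rewrite lt_eqF.
  have bxc : b * (`|x| / c) <= b `^ alpha.
    have a1 : 0 < 1 - alpha by rewrite subr_gt0.
    have xE : `|x| / c <= expR ((1 - alpha) * (v * t)).
      apply: (@le_trans _ _ ((1 - alpha) * (v * t))); last first.
        by apply: le_trans (expR_ge1Dx _); rewrite lerDr.
      by rewrite [leRHS]mulrC -ler_pdivrMr // -[X in _ / X](gtr0_norm a1).
    have -> : b `^ alpha = b * expR ((1 - alpha) * (v * t)).
      by rewrite bal /b -expRD; congr expR; ring.
    by rewrite ler_wpM2l // ltW.
  have [Cle|] := C_ge x 1 ler01; last by have := normr_ge0 x; clear; lra.
  rewrite -bal; apply: (@le_trans _ _ (2 * (K (alpha, 0) * 1 +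
    (1 + tau alpha) * K (alpha, alpha - 1)) * b `^ alpha)); last by rewrite ler_wpM2r // powR_ge0.
  by move: (ler_wpM2r K00 bxc); clear; lra.
- move=> al1 beta0; apply: le_trans (bounded_skew _) _; first by rewrite beta0 eqxx implybT.
  have [Cle|] := C_ge (x / c) (`|x| / c) xc0; last by rewrite normxc; clear; lra.
  rewrite -bal; apply: (@le_trans _ _ (2 * (K (alpha, 0) * (`|x| / c) +
    (1 + tau alpha) * K (alpha, alpha - 1)) * b `^ alpha)); last by rewrite ler_wpM2r // powR_ge0.
  have bE : b `^ alpha = b by rewrite al1 powRr1 // ltW.
  by rewrite bE; clear; lra.
- move=> al1 x0; apply: le_trans (bounded_skew _) _; first by rewrite gt_eqF.
  have [Cle|] := C_ge x 0 (lexx _); last by have := normr_ge0 x; clear; lra.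
  rewrite -bal; apply: (@le_trans _ _ (2 * (K (alpha, 0) * 0 +
    (1 + tau alpha) * K (alpha, alpha - 1)) * b `^ alpha)); last by rewrite ler_wpM2r // powR_ge0.
  by rewrite x0 normr0; clear; lra.
move=> al1 _.
have vt0 : 0 <= v * t by rewrite (le_trans ler01).
apply: le_trans (Kolmogorov_Cauchy_skew c0 b0 b_small XY stYe al1 beta_le1 erefl vt0 _ _ _) _.
- by move=> a' b'; exact: HK100.
- by move=> a' b'; exact: HK110.
- by move=> a' b'; exact: HK1h.
have b_ge0 := ltW b0.
pose r := v * t.
(* Each of the four terms is at most [v t] by the choice of the threshold. *)
have S0 : `|x| / c + 1 + `|ln c| + v * t <= 4 * r.
  by rewrite -/r in vt1 xc_vt lnc_vt *; move: vt1 xc_vt lnc_vt; clear; lra.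
have B0 : 2 * b * (`|x| / c + 1 + `|ln c| + v * t) * K (1, 0) <= 2 * b * (4 * r) * K (1, 0).
  by rewrite ler_wpM2r // ler_wpM2l // mulr_ge0.
have B1 : 2 * b * K (1, 1) <= 2 * b * K (1, 1) * r.
  by rewrite ler_peMr // !mulr_ge0.
have B2 : 4 * b * K (1, - (1 / 2)) <= 4 * b * K (1, - (1 / 2)) * r.
  by rewrite ler_peMr // !mulr_ge0.
have CB : (8 * K (1, 0) + 2 * K (1, 1) + 4 * K (1, - (1 / 2))) * (r * b) <= C x alpha * (r * b).
  rewrite /C; apply: ler_wpM2r; first by rewrite mulr_ge0.
  by rewrite lerDr mulr_ge0 // addr_ge0 // mulr_ge0 // addr_ge0.
apply: le_trans CB; rewrite -/r; move: B0 B1 B2; rewrite -/r; clear; lra.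
Qed.
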